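(* Let $H$ be a separable Hilbert space and let $A \subset B(H)$ be a separable $C^*$-algebra. Then $A$ is a quasidiagonal set of operators if and only if for every finite set $\mathcal{F} \subset A$ and every $\varepsilon > 0$ there exists a block diagonal algebra $B \subset B(H)$ such that $\mathcal{F} \subset^{\varepsilon} B$ and $A + \mathcal{K}(H) = B + \mathcal{K}(H)$.
   Context: $\mathcal{K}(H)$ denotes the compact operators on $H$. All $C^*$-algebras considered (including $B$) are separable. A subset $\Omega \subset B(H)$ is a quasidiagonal set of operators if for each finite set $\omega \subset \Omega$, each finite set $\chi \subset H$ and each $\varepsilon > 0$ there exists a finite rank (orthogonal) projection $P \in B(H)$ such that $\|TP - PT\| \leq \varepsilon$ and $\|P(x) - x\| \leq \varepsilon$ for all $T \in \omega$ and $x \in \chi$. A $C^*$-algebra $B \subset B(H)$ is a block diagonal algebra if there exists an increasing sequence of finite rank projections $P_1 \leq P_2 \leq P_3 \leq \cdots$ in $B(H)$ such that $bP_n = P_n b$ for all $b \in B$, $n \in \mathbb{N}$, and $P_n \to 1_H$ in the strong operator topology. For sets of operators $F, B \subset B(H)$, $F \subset^{\varepsilon} B$ means that for each $x \in F$ there exists $y \in B$ with $\|x - y\| < \varepsilon$. *)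

(* Defs.v *)
From HB Require Import structures.
From mathcomp Require Import all_boot all_order all_algebra.
From mathcomp Require Import sesquilinear.
From mathcomp Require Import complex.
From mathcomp Require Import all_classical all_reals all_analysis.
Set Implicit Arguments.
Unset Strict Implicit.
Unset Printing Implicit Defensive.
Import Order.TTheory GRing.Theory Num.Theory.
Import numFieldNormedType.Exports.
Local Open Scope classical_set_scope.
Local Open Scope ring_scope.
Local Open Scope complex_scope.

Definition bounded_linear (R : realType) (H : normedModType R[i]) :
    {pred H -> H} :=
  fun f => `[< linear f /\ exists M : R, forall x, `|f x| <= M%:C * `|x| >].

(* B(H) *)
Record bop (R : realType) (H : normedModType R[i]) := Bop {
  bop_fun :> H -> H;
  _ : bop_fun \in @bounded_linear R H }.

HB.instance Definition _ (R : realType) (H : normedModType R[i]) :=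
  [isSub for @bop_fun R H].
HB.instance Definition _ (R : realType) (H : normedModType R[i]) :=
  [Choice of bop H by <:].

Section BoundedOperators.
Variables (R : realType) (H : normedModType R[i]).
Implicit Types (f g : H -> H) (S T : bop H) (x y : H).

Lemma bounded_linearP f : reflect
  (linear f /\ exists M : R, forall x, `|f x| <= M%:C * `|x|)
  (f \in @bounded_linear R H).
Proof. exact: asboolP. Qed.

Let ReK (a : R[i]) : 0 <= a -> (complex.Re a)%:C = a.
Proof. by move=> a0; rewrite RRe_real ?ger0_real. Qed.

Let CD (a b : R) : (a + b)%:C = a%:C + b%:C.
Proof. exact: (rmorphD (real_complex R)). Qed.

Let CM (a b : R) : (a * b)%:C = a%:C * b%:C.
Proof. exact: (rmorphM (real_complex R)). Qed.

Lemma bounded_linear_submod : submod_closed (@bounded_linear R H).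
Proof.
split=> [|a f g /bounded_linearP[lf [M Mf]] /bounded_linearP[lg [N Ng]]].
  apply/bounded_linearP; split=> [a x y|]; first by rewrite /= scaler0 addr0.
  by exists 0 => x; rewrite normr0 mul0r.
apply/bounded_linearP; split=> [b x y|].
  rewrite !fctE lf lg !scalerDr !scalerA (mulrC a b) -!addrA; congr (_ + _).
  by rewrite addrCA.
exists (complex.Re `|a| * M + N) => x; rewrite !fctE.
rewrite (le_trans (ler_normD _ _))// CD mulrDl lerD// normrZ.
by rewrite CM ReK// -mulrA ler_wpM2l.
Qed.

HB.instance Definition _ :=
  GRing.isSubmodClosed.Build R[i] (H -> H) (@bounded_linear R H)
    bounded_linear_submod.
HB.instance Definition _ := [SubChoice_isSubLmodule of bop H by <:].

Lemma bopP T : linear T /\ exists M : R, forall x, `|T x| <= M%:C * `|x|.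
Proof. exact/bounded_linearP/(valP T). Qed.

Lemma bop_ext S T : (forall x, S x = T x) -> S = T.
Proof. by move=> ST; apply/val_inj/funext. Qed.

Lemma bopD S T x : (S + T) x = S x + T x. Proof. by []. Qed.
Lemma bopN T x : (- T) x = - T x. Proof. by []. Qed.
Lemma bopZ (a : R[i]) T x : (a *: T) x = a *: T x. Proof. by []. Qed.
Lemma bop0 x : (0 : bop H) x = 0. Proof. by []. Qed.

HB.instance Definition _ T := GRing.isLinear.Build R[i] H H *:%R T (bopP T).1.

Lemma bop_id_subproof : idfun \in @bounded_linear R H.
Proof.
apply/bounded_linearP; split=> //.
by exists 1 => x; rewrite mul1r.
Qed.

Lemma bop_comp_subproof S T : S \o T \in @bounded_linear R H.
Proof.
apply/bounded_linearP; split=> [a x y /=|]; first by rewrite !linearP.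
have [[_ [M MS]] [_ [N NT]]] := (bopP S, bopP T).
exists (`|M| * `|N|) => x /=; rewrite CM -mulrA.
have leC (r : R) : r%:C <= `|r|%:C by rewrite lecR ler_norm.
rewrite (le_trans (MS _))// (le_trans (ler_wpM2r _ (leC M)))//.
rewrite ler_wpM2l// ?lecR// (le_trans (NT _))//.
by rewrite (le_trans (ler_wpM2r _ (leC N))).
Qed.

Definition bop_one : bop H := Bop bop_id_subproof.
Definition bop_mul S T : bop H := Bop (bop_comp_subproof S T).

Let bop_mulA : associative bop_mul. Proof. by move=> S T U; apply: bop_ext. Qed.
Let bop_mul1 : left_id bop_one bop_mul. Proof. by move=> T; apply: bop_ext. Qed.
Let bop_mulr1 : right_id bop_one bop_mul. Proof. by move=> T; apply: bop_ext. Qed.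
Let bop_mulDl : left_distributive bop_mul +%R.
Proof. by move=> S T U; apply: bop_ext. Qed.
Let bop_mulDr : right_distributive bop_mul +%R.
Proof. by move=> S T U; apply: bop_ext => x; exact: (linearD S). Qed.

HB.instance Definition _ := GRing.Zmodule_isPzRing.Build (bop H)
  bop_mulA bop_mul1 bop_mulr1 bop_mulDl bop_mulDr.

Lemma bopM S T x : (S * T) x = S (T x). Proof. by []. Qed.
Lemma bop1 x : (1 : bop H) x = x. Proof. by []. Qed.

(* complex.Re because norms of H take their (real) values in R[i] *)
Definition opnorm T : R :=
  sup [set complex.Re `|T x| | x in [set x : H | `|x| <= 1]].

Lemma opnorm_has_sup T :
  has_sup [set complex.Re `|T x| | x in [set x : H | `|x| <= 1]].
Proof.
split; first by exists (complex.Re `|T 0|), 0; rewrite //= normr0.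
have [_ [M MT]] := bopP T; exists `|M| => _ [y /= y1 <-].
rewrite -lecR ReK// (le_trans (MT y))//.
rewrite (@le_trans _ _ (`|M|%:C * `|y|))//.
  by rewrite ler_wpM2r// lecR ler_norm.
by rewrite ler_piMr// lecR.
Qed.

Lemma opnorm_ge0 T : 0 <= opnorm T.
Proof.
apply: (@le_trans _ _ (complex.Re `|T 0|)); first by rewrite -ler0c ReK.
apply: ub_le_sup; first by have [] := opnorm_has_sup T.
by exists 0; rewrite //= normr0.
Qed.

Lemma le_opnorm T x : `|T x| <= (opnorm T)%:C * `|x|.
Proof.
have [->|x0] := eqVneq x 0; first by rewrite linear0 !normr0 mulr0 lexx.
have nx : 0 < `|x| by rewrite normr_gt0.
rewrite -ler_pdivrMr//.
have -> : `|T x| / `|x| = `|T (`|x|^-1 *: x)|.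
  by rewrite linearZ normrZ normfV normr_id mulrC.
rewrite -[leLHS]ReK// lecR; apply: ub_le_sup.
  by have [] := opnorm_has_sup T.
by exists (`|x|^-1 *: x) => //=; rewrite normrZ normfV normr_id mulVf// gt_eqF.
Qed.

Lemma opnorm_le T (M : R) :
  (forall x, `|T x| <= M%:C * `|x|) -> 0 <= M -> opnorm T <= M.
Proof.
move=> MT M0; apply: ge_sup.
  by exists (complex.Re `|T 0|), 0; rewrite //= normr0.
move=> _ [x /= x1 <-]; rewrite -lecR ReK// (le_trans (MT x))//.
by rewrite ler_piMr// lecR.
Qed.

Lemma opnormD S T : (opnorm (S + T))%:C <= (opnorm S)%:C + (opnorm T)%:C.
Proof.
rewrite -CD lecR opnorm_le ?addr_ge0 ?opnorm_ge0// => x.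
by rewrite bopD (le_trans (ler_normD _ _))// CD mulrDl lerD// le_opnorm.
Qed.

Lemma opnormZ (a : R[i]) T : (opnorm (a *: T))%:C = `|a| * (opnorm T)%:C.
Proof.
have le b U : (opnorm (b *: U))%:C <= `|b| * (opnorm U)%:C.
  rewrite -[`|b|]ReK// -CM lecR; apply: opnorm_le => [x|].
    rewrite bopZ normrZ CM ReK// -mulrA.
    by rewrite ler_wpM2l// le_opnorm.
  by rewrite mulr_ge0 ?opnorm_ge0// -ler0c ReK.
apply/eqP; rewrite eq_le le/=; have [->|a0] := eqVneq a 0.
  by rewrite normr0 mul0r ler0c opnorm_ge0.
have := le a^-1 (a *: T); rewrite scalerA mulVf// scale1r normfV.
by rewrite mulrC ler_pdivlMr ?normr_gt0// mulrC.
Qed.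

Lemma opnorm_eq0 T : (opnorm T)%:C = 0 -> T = 0.
Proof.
move=> T0; apply: bop_ext => x; apply/eqP; rewrite -normr_le0.
by have := le_opnorm T x; rewrite T0 mul0r.
Qed.

(* The resulting topology on B(H) is the norm topology. *)
HB.instance Definition _ := Lmodule_isNormed.Build R[i] (bop H)
  opnormD opnormZ opnorm_eq0.

Lemma bop_normE T : `|T| = (opnorm T)%:C. Proof. by []. Qed.

End BoundedOperators.

Definition separable_set (X : topologicalType) (A : set X) :=
  exists D : set X, [/\ countable D, D `<=` A & A `<=` closure D].

Section Operators.
Variables (R : realType) (H : normedModType R[i]).
Variable dot : {dot H for @Num.conj R[i]}.
Implicit Types (S T P Q : bop H) (A B F : set (bop H)).

(* S is the adjoint of T; dot is linear in its first argument *)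
Definition adjoint T S := forall x y, dot (T x) y = dot x (S y).

(* not necessarily unital, and not necessarily nondegenerate *)
Definition cstar_algebra A :=
  [/\ [/\ A 0,
          (forall S T, A S -> A T -> A (S + T)) &
          (forall (a : R[i]) T, A T -> A (a *: T))],
      (forall S T, A S -> A T -> A (S * T)),
      (forall T, A T -> exists2 S, A S & adjoint T S) &
      closed A].

Definition compact_operator T :=
  precompact [set T x | x in [set x : H | `|x| <= 1]].

Definition compact_operators : set (bop H) := [set T | compact_operator T].

Definition projection P := P * P = P /\ adjoint P P.

Definition finite_rank T := exists n (v : 'I_n -> H),
  forall x, exists c : 'I_n -> R[i], T x = \sum_(i < n) c i *: v i.

(* the usual order on self-adjoint operators; <= on R[i] forces both sides to
   differ by a nonnegative real *)
Definition op_le S T := forall x, dot (S x) x <= dot (T x) x.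

Definition quasidiagonal_set (Omega : set (bop H)) :=
  forall (omega : set (bop H)) (chi : set H) (eps : R),
    finite_set omega -> omega `<=` Omega -> finite_set chi -> 0 < eps ->
  exists P, [/\ projection P, finite_rank P,
    (forall T, omega T -> `|T * P - P * T| <= eps%:C) &
    (forall x, chi x -> `|P x - x| <= eps%:C)].

Definition block_diagonal_algebra B :=
  cstar_algebra B /\
  exists P : nat -> bop H,
    [/\ (forall n, projection (P n) /\ finite_rank (P n)),
        (forall n, op_le (P n) (P n.+1)),
        (forall T n, B T -> T * P n = P n * T) &
        (forall x, (fun n => P n x) @ \oo --> x)].

Definition approx_contained F (eps : R) B :=
  forall S, F S -> exists2 T, B T & `|S - T| < eps%:C.

Definition setsum A B := [set S + T | S in A & T in B].

End Operators.

(* Main.v *)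
Require Import Defs.
From HB Require Import structures.
From mathcomp Require Import all_boot all_order all_algebra.
From mathcomp Require Import sesquilinear.
From mathcomp Require Import complex.
From mathcomp Require Import all_classical all_reals all_analysis.
From mathcomp Require Import ring lra.
Set Implicit Arguments.
Unset Strict Implicit.
Unset Printing Implicit Defensive.
Import Order.TTheory GRing.Theory Num.Theory.
Import numFieldNormedType.Exports.
Local Open Scope classical_set_scope.
Local Open Scope ring_scope.
Local Open Scope complex_scope.

(** Suppose first that the algebras B exist. If P_n are the projections
    reducing B and T is within eps/2 of S in B, then
    [T, P_n] = [T - S, P_n] has norm at most eps, and P_n tends strongly to 1.

    Conversely, perturbing the projections given by quasidiagonality produces
    finite rank projections 0 = P_0 <= P_1 <= ... tending strongly to 1 with
    [T, P_n] geometrically small for every T in a dense sequence of A. With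
    E_n = P_(n+1) - P_n let D(T) be the strong sum of the E_n T E_n. It is a
    *-preserving contraction and T - D(T) is the norm convergent sum of the
    finite rank operators [T, E_n] E_n, hence compact, and small when all the
    [T, P_n] are small. Take for B the operators in A + K(H) commuting with
    every P_n. The nontrivial point is that B is closed, which follows from
    A + K(H) being closed. This is obtained without functional calculus: if X
    in A has norm at most M and distance at most d <= M to K(H), then
    X - X X^* X / M^2 has norm at most M / 2, distance at most d to K(H), and
    differs from X by at most d^3 / M^2 modulo K(H). Iterating, an element of
    A at distance d from K(H) is, up to d/12 modulo K(H), of norm at most 2d. *)

(** * Geometric decay and the embedding of the reals into the complex numbers *)

Lemma geometric_lt (R : realType) (C e : R) :
  0 < e -> exists n, C / 2 ^+ n < e.
Proof.
move=> e0; exists (Num.bound (`|C / e|)).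
rewrite ltr_pdivrMr ?exprn_gt0// -ltr_pdivrMl// mulrC.
apply: le_lt_trans (ler_norm _) _.
apply: lt_le_trans (archi_boundP _) _ => //.
by rewrite -natrX ler_nat; exact/ltnW/ltn_expl.
Qed.

Lemma real_complexD (R : realType) (a b : R) : (a + b)%:C = a%:C + b%:C.
Proof. exact: (rmorphD (real_complex R)). Qed.

Lemma real_complexM (R : realType) (a b : R) : (a * b)%:C = a%:C * b%:C.
Proof. exact: (rmorphM (real_complex R)). Qed.

Lemma real_complexX (R : realType) (a : R) n : (a ^+ n)%:C = a%:C ^+ n.
Proof. exact: (rmorphXn (real_complex R)). Qed.

(** * Real-valued norms of vectors and operators *)

Section RealNorm.
Variables (R : realType) (H : normedModType R[i]).
Implicit Types (x y z : H) (S T U : bop H).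

(** Norms take values in [R[i]], whose order is only partial; the real part gives access to the
    total order of [R] and to [lra]. On [bop H] it reduces to [opnorm], so facts about [hn] also
    serve for operators. *)
Definition hn x : R := complex.Re `|x|.

Lemma hnE x : `|x| = (hn x)%:C.
Proof. by rewrite /hn RRe_real// ger0_real. Qed.

Lemma hn_ge0 x : 0 <= hn x.
Proof. by rewrite -ler0c -hnE. Qed.

Lemma hn0 : hn (0 : H) = 0.
Proof. by apply: complexI; rewrite -hnE normr0. Qed.

Lemma hn_eq0 x : hn x = 0 -> x = 0.
Proof. by move=> x0; apply/eqP; rewrite -normr_eq0 hnE x0. Qed.

Lemma hnD x y : hn (x + y) <= hn x + hn y.
Proof. by rewrite -lecR real_complexD -!hnE ler_normD. Qed.

Lemma hnN x : hn (- x) = hn x.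
Proof. by rewrite /hn normrN. Qed.

Lemma hnB x y : hn (x - y) <= hn x + hn y.
Proof. by rewrite -[hn y]hnN hnD. Qed.

Lemma hnC x y : hn (x - y) = hn (y - x).
Proof. by rewrite -hnN opprB. Qed.

Lemma hn_trans y x z : hn (x - z) <= hn (x - y) + hn (y - z).
Proof. by rewrite (le_trans _ (hnD _ _))// addrA subrK. Qed.

Lemma hnZ (a : R[i]) x : hn (a *: x) = complex.Re `|a| * hn x.
Proof.
by apply: complexI; rewrite real_complexM -!hnE normrZ RRe_real// ger0_real.
Qed.

Lemma hn_sum (I : Type) (r : seq I) (F : I -> H) :
  hn (\sum_(i <- r) F i) <= \sum_(i <- r) hn (F i).
Proof.
elim/big_rec2: _ => [|i y z _ h]; first by rewrite hn0.
by rewrite (le_trans (hnD _ _))// lerD2l.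
Qed.

Lemma le_op T x : hn (T x) <= opnorm T * hn x.
Proof. by rewrite -lecR real_complexM -!hnE le_opnorm. Qed.

Lemma op_le T (M : R) :
  0 <= M -> (forall x, hn (T x) <= M * hn x) -> opnorm T <= M.
Proof.
by move=> M0 h; apply: opnorm_le => // x; rewrite !hnE -real_complexM lecR.
Qed.

Lemma le_op_trans T (M : R) x : opnorm T <= M -> hn (T x) <= M * hn x.
Proof.
by move=> h; rewrite (le_trans (le_op _ _))// ler_wpM2r// hn_ge0.
Qed.

Lemma op_le_ball T (M : R) :
  (forall x, hn x <= 1 -> hn (T x) <= M) -> opnorm T <= M.
Proof.
move=> h; apply: ge_sup.
  by exists (complex.Re `|T 0|), 0; rewrite //= normr0.
by move=> _ [x /= x1 <-]; apply: h; rewrite -lecR -hnE.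
Qed.

Lemma opnormB_sym S T : opnorm (S - T) = opnorm (T - S).
Proof. by apply: complexI; rewrite -!bop_normE distrC. Qed.

Lemma opnorm0 : opnorm (0 : bop H) = 0.
Proof. by apply: complexI; rewrite -bop_normE normr0. Qed.

Lemma opnorm_triangle S T : opnorm (S + T) <= opnorm S + opnorm T.
Proof. by rewrite -lecR real_complexD opnormD. Qed.

Lemma opnorm_dist_triangle T S U :
  opnorm (S - U) <= opnorm (S - T) + opnorm (T - U).
Proof. by rewrite (le_trans _ (opnorm_triangle _ _))// addrA subrK. Qed.

Lemma opnormN T : opnorm (- T) = opnorm T.
Proof. by apply: complexI; rewrite -!bop_normE normrN. Qed.

Lemma opnormB S T : opnorm (S - T) <= opnorm S + opnorm T.
Proof. by rewrite -[opnorm T]opnormN opnorm_triangle. Qed.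

Lemma opnormM S T : opnorm (S * T) <= opnorm S * opnorm T.
Proof.
apply: op_le => [|x]; first by rewrite mulr_ge0 ?opnorm_ge0.
rewrite bopM (le_trans (le_op _ _))// -mulrA ler_wpM2l ?opnorm_ge0//.
exact: le_op.
Qed.

Lemma bop_linD T x y : T (x + y) = T x + T y. Proof. exact: linearD. Qed.
Lemma bop_linB T x y : T (x - y) = T x - T y. Proof. exact: linearB. Qed.
Lemma bop_linZ a T x : T (a *: x) = a *: T x. Proof. exact: linearZ. Qed.
Lemma bop_lin_sum (I : Type) (r : seq I) (P : pred I) (F : I -> H) T :
  T (\sum_(i <- r | P i) F i) = \sum_(i <- r | P i) T (F i).
Proof. exact: linear_sum. Qed.
Lemma bop_lin0 T : T 0 = 0. Proof. exact: linear0. Qed.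

Lemma bopB S T x : (S - T) x = S x - T x. Proof. by []. Qed.

Lemma bop_sum (I : Type) (r : seq I) (F : I -> bop H) x :
  (\sum_(i <- r) F i) x = \sum_(i <- r) F i x.
Proof. by elim/big_rec2: _ => // i y z _ <-. Qed.

Lemma cvg_hnP (u : nat -> H) x :
  u @ \oo --> x <->
  forall e : R, 0 < e -> exists N, forall n, (N <= n)%N -> hn (x - u n) <= e.
Proof.
split=> [/cvgrPdist_le h e e0|h].
  have e0C : 0 < e%:C by rewrite (@ltcR R 0).
  have [N _ NP] := h _ e0C.
  by exists N => n /NP /=; rewrite hnE lecR.
apply/cvgrPdist_le => e e0.
have e0R : 0 < complex.Re e by rewrite -(@ltcR R 0) RRe_real// gtr0_real.
have [N NP] := h _ e0R.
exists N => // n /NP /=; rewrite -lecR -hnE RRe_real// gtr0_real//.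
Qed.

Lemma cauchy_hn_lim (C : R) (u : nat -> H) x :
  u @ \oo --> x ->
  (forall n m, (n <= m)%N -> hn (u m - u n) <= C / 2 ^+ n) ->
  forall n, hn (x - u n) <= C / 2 ^+ n.
Proof.
move=> ux h n; apply/ler_addgt0Pr => e e0.
have [N NP] := (cvg_hnP _ _).1 ux _ e0.
have h1 := NP (maxn N n) (leq_maxl _ _).
rewrite (le_trans (hn_trans (u (maxn N n)) _ _))//.
by rewrite addrC lerD// h// leq_maxr.
Qed.
End RealNorm.

(** * Completeness in terms of the real-valued norm *)

Section Complete.
Variables (R : realType) (H : completeNormedModType R[i]).

Lemma cauchy_hn_cvg (u : nat -> H) :
  (forall e : R, 0 < e -> exists n, forall m, (n <= m)%N -> hn (u m - u n) <= e) ->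
  exists x : H, u @ \oo --> x.
Proof.
move=> h; suff ucvg : cvg (u @ \oo) by exists (lim (u @ \oo)).
apply/cauchy_cvgP/cauchy_exP => e e0.
have r0 : 0 < complex.Re e by rewrite -(@ltcR R 0) RRe_real// gtr0_real.
have [n nP] := h (complex.Re e / 2) (divr_gt0 r0 (ltr0n R 2)).
exists (u n); exists n => // m /= /nP h'.
rewrite -ball_normE /= distrC hnE -[ltRHS]RRe_real ?gtr0_real// ltcR.
by rewrite (le_lt_trans h')// ltr_pdivrMr// mulr_natr mulr2n ltrDl.
Qed.

End Complete.

(** * Inner products, adjoints, projections and finite rank operators *)

Section InnerProduct.
Variables (R : realType) (H : normedModType R[i]).
Variable dot : {dot H for @Num.conj R[i]}.
Hypothesis dot_norm : forall x : H, `|x| ^+ 2 = dot x x.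
Implicit Types (x y z e f : H) (P Q S T U : bop H).

Lemma dotC x y : dot x y = (dot y x)^*%R.
Proof. by have := @hermC _ _ _ _ dot x y; rewrite expr0 mul1r. Qed.

Lemma dotDl x y z : dot (x + y) z = dot x z + dot y z.
Proof. exact: linearDl. Qed.
Lemma dotDr x y z : dot z (x + y) = dot z x + dot z y.
Proof. exact: linearDr. Qed.
Lemma dotBl x y z : dot (x - y) z = dot x z - dot y z.
Proof. exact: linearBl. Qed.
Lemma dotBr x y z : dot z (x - y) = dot z x - dot z y.
Proof. exact: linearBr. Qed.
Lemma dotZl a x z : dot (a *: x) z = a * dot x z.
Proof. exact: linearZl_LR. Qed.
Lemma dotZr a x z : dot z (a *: x) = a^*%R * dot z x.
Proof. exact: linearZr_LR. Qed.
Lemma dot0l x : dot 0 x = 0. Proof. exact: linear0l. Qed.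
Lemma dot0r x : dot x 0 = 0. Proof. exact: linear0r. Qed.

Lemma hn_sqr x : (hn x ^+ 2)%:C = dot x x.
Proof. by rewrite real_complexX -dot_norm hnE. Qed.

Lemma dot_ge0 x : 0 <= dot x x.
Proof. by rewrite -hn_sqr ler0c sqr_ge0. Qed.

Lemma hn_sqrE x : hn x ^+ 2 = complex.Re (dot x x).
Proof. by rewrite -hn_sqr. Qed.

Lemma Re_conj (a : R[i]) : complex.Re a^*%R = complex.Re a.
Proof. by case: a. Qed.

Lemma ReD (a b : R[i]) : complex.Re (a + b) = complex.Re a + complex.Re b.
Proof. by case: a b => [a1 a2] [b1 b2]. Qed.

Lemma ReN (a : R[i]) : complex.Re (- a) = - complex.Re a.
Proof. by case: a. Qed.

Lemma hnB_sqr x y :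
  hn (x - y) ^+ 2 = hn x ^+ 2 - 2 * complex.Re (dot x y) + hn y ^+ 2.
Proof.
rewrite !hn_sqrE dotBl !dotBr !(ReD, ReN) (dotC y x) Re_conj; lra.
Qed.

Lemma hnD_sqr x y : dot x y = 0 -> hn (x + y) ^+ 2 = hn x ^+ 2 + hn y ^+ 2.
Proof.
move=> xy; rewrite !hn_sqrE dotDl !dotDr !ReD (dotC y x) Re_conj xy /=; lra.
Qed.

(** After squaring and dividing by [dot y y], the difference of the two sides is the squared norm of
    the component of [x] orthogonal to [y]. *)
Lemma cauchy_schwarz x y : complex.Re `|dot x y| <= hn x * hn y.
Proof.
have [->|y0] := eqVneq y 0; first by rewrite dot0r normr0 /= hn0 mulr0.
rewrite -(@ler_pXn2r _ 2)// ?nnegrE; last 2 first.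
- by rewrite -ler0c RRe_real// ger0_real.
- by rewrite mulr_ge0 ?hn_ge0.
rewrite -lecR real_complexX RRe_real ?ger0_real//.
rewrite exprMn real_complexM !hn_sqr.
have yy : 0 < dot y y.
  by rewrite lt_neqAle dot_ge0 andbT eq_sym -dot_norm expf_neq0 ?normr_eq0.
rewrite -ler_pdivrMr// -subr_ge0.
suff -> : dot x x - `|dot x y| ^+ 2 / dot y y =
    dot (x - (dot x y / dot y y) *: y) (x - (dot x y / dot y y) *: y).
  exact: dot_ge0.
have -> : `|dot x y| ^+ 2 = dot x y * dot y x by rewrite normCK -dotC.
have cE : (dot x y / dot y y)^*%R = dot y x / dot y y.
  by rewrite rmorphM fmorphV /= -!dotC.
rewrite dotBl !dotBr !dotZl !dotZr cE.
by field; rewrite gt_eqF.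
Qed.

Lemma Re_dot_le x y : complex.Re (dot x y) <= hn x * hn y.
Proof.
apply: le_trans (cauchy_schwarz x y).
rewrite -lecR [leRHS]RRe_real ?ger0_real//.
by rewrite (le_trans _ (normc_ge_Re _))// lecR ler_norm.
Qed.

Lemma dot_ext x y : (forall z, dot x z = dot y z) -> x = y.
Proof.
move=> h; apply/eqP; rewrite -subr_eq0; apply/eqP/hn_eq0/eqP.
by rewrite -sqrf_eq0 hn_sqrE dotBl h subrr.
Qed.

Lemma dot_extr x y : (forall z, dot z x = dot z y) -> x = y.
Proof. by move=> h; apply: dot_ext => z; rewrite dotC h -dotC. Qed.

Notation adj := (adjoint dot).

Lemma adj_sym S T : adj S T -> adj T S.
Proof. by move=> h x y; rewrite dotC -h -dotC. Qed.

Lemma adjD S S' T T' : adj S S' -> adj T T' -> adj (S + T) (S' + T').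
Proof. by move=> h k x y; rewrite !bopD dotDl dotDr h k. Qed.

Lemma adjB S S' T T' : adj S S' -> adj T T' -> adj (S - T) (S' - T').
Proof. by move=> h k x y; rewrite !bopB dotBl dotBr h k. Qed.

Lemma adjZ a S S' : adj S S' -> adj (a *: S) (a^*%R *: S').
Proof. by move=> h x y; rewrite !bopZ dotZl dotZr h conjCK. Qed.

Lemma adjM S S' T T' : adj S S' -> adj T T' -> adj (S * T) (T' * S').
Proof. by move=> h k x y; rewrite !bopM h k. Qed.

Lemma adj1 : adj 1 1. Proof. by []. Qed.

Lemma adj0 : adj 0 0. Proof. by move=> x y; rewrite !bop0 dot0l dot0r. Qed.

Lemma adj_inj S T T' : adj S T -> adj S T' -> T = T'.
Proof. by move=> h k; apply: bop_ext => x; apply: dot_extr => z; rewrite -h k. Qed.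

(** The square of [hn (T x)] is the real part of [dot (S (T x)) x], hence at most
    [opnorm S * hn (T x) * hn x]; cancel [hn (T x)]. *)
Lemma adj_norm S T : adj S T -> opnorm T <= opnorm S.
Proof.
move=> h; apply: op_le => [|x]; first exact: opnorm_ge0.
have [->|Tx0] := eqVneq (hn (T x)) 0; first by rewrite mulr_ge0 ?hn_ge0 ?opnorm_ge0.
have Tx : 0 < hn (T x) by rewrite lt_neqAle eq_sym Tx0 hn_ge0.
rewrite -(ler_pM2r Tx) -expr2 hn_sqrE -h (le_trans (Re_dot_le _ _))//.
rewrite [leRHS]mulrAC ler_wpM2r ?hn_ge0//; exact: le_op.
Qed.

Lemma proj0 : projection dot 0.
Proof. by split; [rewrite mul0r|exact: adj0]. Qed.

Lemma projC P : projection dot P -> projection dot (1 - P).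
Proof.
move=> [PP aP]; split; last exact: adjB adj1 aP.
by rewrite mulrBl mul1r mulrBr mulr1 PP subrr subr0.
Qed.

Lemma projK P x : projection dot P -> P (P x) = P x.
Proof. by move=> [PP _]; rewrite -[LHS]/((P * P) x) PP. Qed.

Lemma proj_dot P x : projection dot P -> dot (P x) x = (hn (P x) ^+ 2)%:C.
Proof. by move=> pP; rewrite hn_sqr -{1}(projK _ pP) pP.2. Qed.

Lemma proj_hn P x : projection dot P -> hn (P x) <= hn x.
Proof.
move=> pP; have := Re_dot_le (P x) x; rewrite proj_dot// => /=.
have [->|x0] := eqVneq (hn (P x)) 0; first by rewrite hn_ge0.
have Tx : 0 < hn (P x) by rewrite lt_neqAle eq_sym x0 hn_ge0.
by rewrite expr2 ler_pM2l.
Qed.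

Lemma proj_opnorm P : projection dot P -> opnorm P <= 1.
Proof. by move=> pP; apply: op_le => // x; rewrite mul1r proj_hn. Qed.

Lemma proj_mul_opnorm P T : projection dot P -> opnorm (P * T) <= opnorm T.
Proof.
move=> pP; rewrite (le_trans (opnormM _ _))// -[leRHS]mul1r.
by rewrite ler_wpM2r ?opnorm_ge0// proj_opnorm.
Qed.

Lemma mul_proj_opnorm P T : projection dot P -> opnorm (T * P) <= opnorm T.
Proof.
move=> pP; rewrite (le_trans (opnormM _ _))// -[leRHS]mulr1.
by rewrite ler_wpM2l ?opnorm_ge0// proj_opnorm.
Qed.

Lemma rank1_subproof e f : (fun x => dot x f *: e) \in @bounded_linear R H.
Proof.
apply/bounded_linearP; split=> [a x y|].
  by rewrite dotDl dotZl scalerDl scalerA.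
exists (hn f * hn e) => x; rewrite !hnE -real_complexM lecR.
rewrite hnZ mulrAC ler_wpM2r ?hn_ge0// mulrC.
exact: cauchy_schwarz.
Qed.

Definition rank1 e f : bop H := Bop (rank1_subproof e f).

Lemma rank1E e f x : rank1 e f x = dot x f *: e. Proof. by []. Qed.

Lemma adj_rank1 e f : adj (rank1 e f) (rank1 f e).
Proof. by move=> x y; rewrite !rank1E dotZl dotZr -dotC mulrC. Qed.

Lemma opnorm_rank1 e f : opnorm (rank1 e f) <= hn e * hn f.
Proof.
apply: op_le => [|x]; first by rewrite mulr_ge0 ?hn_ge0.
by rewrite rank1E hnZ -mulrA mulrC ler_wpM2l ?hn_ge0// mulrC cauchy_schwarz.
Qed.

Lemma mul_rank1 T e f : T * rank1 e f = rank1 (T e) f.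
Proof. by apply: bop_ext => x; rewrite bopM !rank1E linearZ. Qed.

Lemma rank1_mul T T' e f : adj T T' -> rank1 e f * T = rank1 e (T' f).
Proof. by move=> h; apply: bop_ext => x; rewrite bopM !rank1E h. Qed.

(** For an orthonormal list this is the projection onto its span. Keeping the list allows products
    with it to be expanded into rank one operators and treated by induction. *)
Definition diag_sum (s : seq H) : bop H := \sum_(v <- s) rank1 v v.

Definition subspace (V : set H) :=
  [/\ V 0, (forall x y, V x -> V y -> V (x + y)) & forall a x, V x -> V (a *: x)].

(* Gram-Schmidt: each step adds the normalised component of the new vector
   orthogonal to the range of the projection already built *)
Lemma proj_span (s : seq H) : exists t : seq H,
  [/\ projection dot (diag_sum t), (forall v, v \in s -> diag_sum t v = v) &
     forall V, subspace V -> (forall v, v \in s -> V v) ->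
       forall x, V (diag_sum t x)].
Proof.
elim: s => [|w s [t [pP fP VP]]].
  exists [::]; rewrite /diag_sum big_nil; split=> // [|V [V0 _ _] _ x].
    exact: proj0.
  by rewrite bop0.
set P := diag_sum t in pP fP VP *.
pose u := w - P w.
have [u0|u0] := eqVneq u 0.
  exists t; split=> // [v|V sV sVs x].
    rewrite inE => /predU1P[->|/fP//].
    by apply/eqP; rewrite eq_sym -subr_eq0 -/P -/u u0.
  by apply: VP => // v vs; apply: sVs; rewrite inE vs orbT.
have hu0 : hn u != 0 by apply: contra_neq u0 => /hn_eq0.
pose e := ((hn u)^-1)%:C *: u.
have ReC (r : R) : (r%:C)^*%R = r%:C by apply/CrealP; rewrite complex_real.
have ee : dot e e = 1.
  rewrite dotZl dotZr ReC -hn_sqr -!real_complexM expr2.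
  by rewrite mulKf// mulVf.
have Pu : P u = 0 by rewrite bop_linB projK// subrr.
have Pe : P e = 0 by rewrite bop_linZ Pu scaler0.
have Qe : rank1 e e e = e by rewrite rank1E ee scale1r.
have Pr : P * rank1 e e = 0.
  by apply: bop_ext => x; rewrite mul_rank1 rank1E Pe scaler0.
have rP : rank1 e e * P = 0.
  by apply: bop_ext => x; rewrite (rank1_mul _ _ pP.2) rank1E Pe dot0r scale0r.
have rr : rank1 e e * rank1 e e = rank1 e e by rewrite mul_rank1 Qe.
(* Split [w = u + P w]; the second term is killed because [rank1 e e * P = 0]. *)
have Ew : rank1 e e w = u.
  have -> : rank1 e e w = rank1 e e u + (rank1 e e * P) w.
    by rewrite bopM -bop_linD subrK.
  rewrite rP bop0 addr0 rank1E dotZr ReC -hn_sqr scalerA -!real_complexM.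
  by rewrite expr2 mulKf// mulfV// scale1r.
exists (e :: t); rewrite /diag_sum big_cons -/(diag_sum t) -/P; split.
- split; last exact: adjD (adj_rank1 _ _) pP.2.
  by rewrite mulrDl !mulrDr rr rP Pr pP.1 addr0 add0r.
- move=> v; rewrite inE => /predU1P[->|vs]; rewrite bopD.
    by rewrite Ew subrK.
  rewrite fP// -[X in rank1 e e X](fP _ vs) -[rank1 e e _]/((rank1 e e * P) v).
  by rewrite rP add0r.
- move=> V sV sVs x; have [V0 VD VZ] := sV; rewrite bopD; apply: (VD).
    rewrite rank1E; apply: (VZ); apply: (VZ); apply: (VD).
      by apply: sVs; rewrite inE eqxx.
    rewrite -scaleN1r; apply: (VZ); apply: VP => // v vs.
    by apply: sVs; rewrite inE vs orbT.
  by apply: VP => // v vs; apply: sVs; rewrite inE vs orbT.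
Qed.

Lemma finite_rank_diag_sum (s : seq H) T : finite_rank (diag_sum s * T).
Proof.
exists (size s), (fun i => nth 0 s i) => x; exists (fun i => dot (T x) (nth 0 s i)).
by rewrite bopM bop_sum (big_nth 0) big_mkord.
Qed.

(** Project onto the span of the spanning vectors of both operators. A common projection is what
    makes finite rank stable under sums. *)
Lemma finite_rank_fixed S T : finite_rank S -> finite_rank T ->
  exists s, [/\ projection dot (diag_sum s), diag_sum s * S = S
               & diag_sum s * T = T].
Proof.
move=> [n [v vP]] [m [w wP]].
have [t [pP fP _]] := proj_span ([seq v i | i : 'I_n] ++ [seq w i | i : 'I_m]).
exists t; split=> //; apply: bop_ext => x; rewrite bopM.
  have [c ->] := vP x; rewrite bop_lin_sum; apply: eq_bigr => i _.
  by rewrite bop_linZ fP// mem_cat fintype.image_f.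
have [c ->] := wP x; rewrite bop_lin_sum; apply: eq_bigr => i _.
by rewrite bop_linZ fP// mem_cat fintype.image_f// orbT.
Qed.

Lemma finite_rankP T : finite_rank T ->
  exists s, projection dot (diag_sum s) /\ diag_sum s * T = T.
Proof. by move=> fT; have [s []] := finite_rank_fixed fT fT; exists s. Qed.

Lemma finite_rank0 : finite_rank (0 : bop H).
Proof. by rewrite -(mulr0 (diag_sum [::])); exact: finite_rank_diag_sum. Qed.

Lemma finite_rankMr S T : finite_rank S -> finite_rank (S * T).
Proof.
by move=> /finite_rankP[s [_ <-]]; rewrite -mulrA; exact: finite_rank_diag_sum.
Qed.

Lemma finite_rankD S T : finite_rank S -> finite_rank T -> finite_rank (S + T).
Proof.
move=> fS fT; have [s [_ <- <-]] := finite_rank_fixed fS fT.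
by rewrite -mulrDr; exact: finite_rank_diag_sum.
Qed.

Lemma finite_rankN S : finite_rank S -> finite_rank (- S).
Proof.
by move=> /finite_rankP[s [_ <-]]; rewrite -mulrN; exact: finite_rank_diag_sum.
Qed.

Lemma finite_rankMl S T : finite_rank T -> finite_rank (S * T).
Proof.
move=> [n [v vP]]; exists n, (S \o v) => x; have [c cP] := vP x; exists c.
by rewrite bopM cP bop_lin_sum; apply: eq_bigr => i _; rewrite bop_linZ.
Qed.

End InnerProduct.

(** * Totally bounded sets and precompactness *)

Section TotallyBounded.
Variables (R : realType) (H : normedModType R[i]).
Implicit Types (x y z : H) (A B : set H).

Lemma nbhs_hnP x (U : set H) :
  nbhs x U <-> exists2 e : R, 0 < e & forall y, hn (x - y) < e -> U y.
Proof.
split=> [/nbhs_normP[e /= e0 eU]|[e e0 eU]].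
  have e0R : 0 < complex.Re e by rewrite -(@ltcR R 0) RRe_real// gtr0_real.
  exists (complex.Re e) => // y xy; apply: eU => /=.
  by rewrite hnE -[ltRHS]RRe_real ?gtr0_real// ltcR.
apply/nbhs_normP; exists e%:C => /=; first by rewrite (@ltcR R 0).
by move=> y /=; rewrite hnE ltcR => /eU.
Qed.

Lemma closure_hnP A x :
  closure A x <-> forall e : R, 0 < e -> exists2 y, A y & hn (x - y) <= e.
Proof.
split=> [cAx e e0|h U /nbhs_hnP[e e0 eU]].
  have /cAx[y [Ay xy]] : nbhs x [set y | hn (x - y) <= e].
    by apply/nbhs_hnP; exists e => // y /ltW.
  by exists y.
have [|y Ay xy] := h (e / 2); first by rewrite divr_gt0.
exists y; split=> //; apply: eU; rewrite (le_lt_trans xy)//.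
by rewrite ltr_pdivrMr// mulr_natr mulr2n ltrDl.
Qed.

(** The net may lie outside [A], so that the property passes to subsets at once. *)
Definition totally_bounded A := forall e : R, 0 < e ->
  exists s : seq H, forall x, A x -> exists2 y, y \in s & hn (x - y) <= e.

Lemma totally_boundedS A B :
  A `<=` B -> totally_bounded B -> totally_bounded A.
Proof. by move=> AB tB e /tB[s sP]; exists s => x /AB/sP. Qed.

Lemma totally_bounded_closure A :
  totally_bounded A -> totally_bounded (closure A).
Proof.
move=> tA e e0; have e20 : 0 < e / 2 by rewrite divr_gt0.
have [s sP] := tA _ e20; exists s => x /closure_hnP/(_ _ e20)[y /sP[z zs yz] xy].
exists z => //; rewrite (le_trans (hn_trans y _ _))//.
by rewrite [leRHS](splitr e) lerD.
Qed.

Lemma totally_boundedD A B : totally_bounded A -> totally_bounded B ->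
  totally_bounded [set x + y | x in A & y in B].
Proof.
move=> tA tB e e0; have e20 : 0 < e / 2 by rewrite divr_gt0.
have [s sP] := tA _ e20; have [t tP] := tB _ e20.
exists [seq x + y | x <- s, y <- t] => _ [x /sP[x' x's xx'] [y /tP[y' y't yy'] <-]].
exists (x' + y'); first exact: allpairs_f.
rewrite opprD addrACA (le_trans (hnD _ _))//.
by rewrite [leRHS](splitr e) lerD.
Qed.

Lemma grid_approx (M d a : R) : 0 < d -> `|a| <= M ->
  exists2 k, (k <= Num.truncn (2 * M / d))%N & `|a - (k%:R * d - M)| <= d.
Proof.
move=> d0; rewrite ler_norml => /andP[Ma aM].
have aM0 : 0 <= (a + M) / d.
  by rewrite divr_ge0 ?(ltW d0)// -lerBlDr sub0r.
exists (Num.truncn ((a + M) / d)).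
  rewrite truncn_ge_nat; last by rewrite divr_ge0 ?(ltW d0)//; lra.
  have /andP[h _] := truncn_itv aM0; rewrite (le_trans h)//.
  by rewrite ler_pM2r ?invr_gt0//; lra.
have /andP[] := truncn_itv aM0.
set k := Num.truncn _; rewrite ler_pdivlMr// ltr_pdivrMr// -natr1 mulrDl mul1r.
by rewrite ler_norml => h1 h2; apply/andP; split; lra.
Qed.

Lemma normC_le_ReIm (c : R[i]) :
  complex.Re `|c| <= `|complex.Re c| + `|complex.Im c|.
Proof.
case: c => a b; rewrite normc_def /=.
rewrite -(@ler_pXn2r _ 2)// ?nnegrE ?sqrtr_ge0 ?addr_ge0//.
rewrite sqr_sqrtr ?addr_ge0 ?sqr_ge0// -(real_normK (num_real a)).
rewrite -(real_normK (num_real b)).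
have := normr_ge0 a; have := normr_ge0 b; nra.
Qed.

Lemma Re_le_normC (c : R[i]) : `|complex.Re c| <= complex.Re `|c|.
Proof.
case: c => a b; rewrite normc_def /= -sqrtr_sqr.
by rewrite ler_sqrt ?addr_ge0 ?sqr_ge0// lerDl sqr_ge0.
Qed.

Lemma Im_le_normC (c : R[i]) : `|complex.Im c| <= complex.Re `|c|.
Proof.
case: c => a b; rewrite normc_def /= -sqrtr_sqr.
by rewrite ler_sqrt ?addr_ge0 ?sqr_ge0// lerDr sqr_ge0.
Qed.

Lemma totally_bounded_disc (e : H) (M : R) :
  totally_bounded [set c *: e | c in [set c : R[i] | complex.Re `|c| <= M]].
Proof.
(* The real and imaginary parts of the coefficient are each approximated within [d], which costs
   [2 * d * hn e]; the added 1 covers [e = 0]. *)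
move=> r r0; pose d := r / (2 * (hn e + 1)).
have he : 0 < hn e + 1 by rewrite ltr_wpDl ?hn_ge0.
have d0 : 0 < d by rewrite divr_gt0// mulr_gt0.
pose g := [seq k%:R * d - M | k <- iota 0 (Num.truncn (2 * M / d)).+1].
have gP a : `|a| <= M -> exists2 b, b \in g & `|a - b| <= d.
  move=> /(grid_approx d0)[k kn kd]; exists (k%:R * d - M) => //.
  by apply/mapP; exists k; rewrite // mem_iota.
exists [seq (a +i* b) *: e | a <- g, b <- g] => _ [c cM <-].
have /gP[a ag ca] := le_trans (Re_le_normC c) cM.
have /gP[b bg cb] := le_trans (Im_le_normC c) cM.
exists ((a +i* b) *: e); first by apply/allpairsPdep; exists a, b.
rewrite -scalerBl hnZ.
rewrite (le_trans (ler_wpM2r (hn_ge0 _) (normC_le_ReIm _)))//.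
case: c ca cb {cM} => c1 c2 /= ca cb.
rewrite (le_trans (ler_wpM2r (hn_ge0 _) (lerD ca cb)))//.
rewrite (@le_trans _ _ ((d + d) * (hn e + 1)))//.
  by rewrite ler_wpM2l ?addr_ge0 ?(ltW d0)// lerDl.
rewrite le_eqVlt /d; apply/orP; left; apply/eqP; field.
by rewrite gt_eqF.
Qed.

Lemma ultra_seq (T : Type) (F : set_system T) (s : seq H) (Q : H -> set T) :
  UltraFilter F -> F [set x | exists2 y, y \in s & Q y x] ->
  exists2 y, y \in s & F (Q y).
Proof.
move=> FU; elim: s => [|y s IH] Fs.
  have /filter_ex[x [y]] := Fs; by rewrite in_nil.
have [Fy|Fy] := in_ultra_setVsetC (Q y) FU.
  by exists y => //; rewrite inE eqxx.
have [|z zs Fz] := IH.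
  apply: filterS (filterI Fs Fy) => x [[z]]; rewrite inE => /predU1P[->//|zs].
  by exists z.
by exists z => //; rewrite inE zs orbT.
Qed.

End TotallyBounded.

(** By pigeonhole over finite nets, an ultrafilter containing the closure of [A] is Cauchy; it
    converges by completeness, and its limit stays in the closure. *)
Lemma totally_bounded_precompact (R : realType)
    (H : completeNormedModType R[i]) (A : set H) :
  totally_bounded A -> precompact A.
Proof.
move=> /totally_bounded_closure tA; rewrite precompactE compact_ultra => F FU FA.
have Fc : cauchy F.
  apply/cauchy_exP => e e0.
  have e0R : 0 < complex.Re e by rewrite -(@ltcR R 0) RRe_real// gtr0_real.
  have e20 : 0 < complex.Re e / 2 by rewrite divr_gt0.
  have [s sP] := tA _ e20.
  have [y _ Fy] : exists2 y, y \in s & F [set x | hn (x - y) <= complex.Re e / 2].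
    by apply: ultra_seq; apply: filterS FA => x /sP.
  exists y; apply: filterS Fy => x /= xy.
  rewrite -ball_normE /= distrC hnE -[ltRHS]RRe_real ?gtr0_real// ltcR.
  by rewrite (le_lt_trans xy)// ltr_pdivrMr// mulr_natr mulr2n ltrDl.
have Fl : F --> lim F by apply: cauchy_cvg.
exists (lim F); split=> //.
apply: closed_closure => B /Fl FB.
exact: filter_ex (filterI FA FB).
Qed.

(** * Distance to the finite rank operators *)

Section Essential.
Variables (R : realType) (H : normedModType R[i]).
Variable dot : {dot H for @Num.conj R[i]}.
Hypothesis dot_norm : forall x : H, `|x| ^+ 2 = dot x x.
Implicit Types (x y z : H) (P Q S T X Y : bop H).

(** A bound on the essential norm, that is, the norm in the Calkin algebra, witnessed by a finite
    rank operator. *)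
Definition ess X (d : R) := exists F, finite_rank F /\ opnorm (X - F) <= d.

(** If a projection [P] fixes the approximant [F], then [X - P * X = (1 - P) * (X - F)], so [P * X]
    approximates [X] at least as well as [F]. *)
Lemma essP X d : ess X d -> exists s, projection dot (diag_sum dot_norm s) /\
  opnorm (X - diag_sum dot_norm s * X) <= d.
Proof.
move=> [F [fF FX]]; have [s [pP PF]] := finite_rankP dot_norm fF.
exists s; split=> //; apply: le_trans FX.
have -> : X - diag_sum dot_norm s * X = (1 - diag_sum dot_norm s) * (X - F).
  by rewrite mulrBr !mulrBl !mul1r PF subrr subr0.
exact (proj_mul_opnorm dot_norm _ (projC pP)).
Qed.

Lemma ess_le X d d' : d <= d' -> ess X d -> ess X d'.
Proof. by move=> dd' [F [fF h]]; exists F; split=> //; exact: le_trans dd'. Qed.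

Lemma ess_opnorm X d : opnorm X <= d -> ess X d.
Proof.
by move=> Xd; exists 0; split; [exact: (finite_rank0 dot_norm)|rewrite subr0].
Qed.

Lemma ess_finite_rank X d : finite_rank X -> 0 <= d -> ess X d.
Proof. by move=> fX d0; exists X; rewrite subrr opnorm0. Qed.

Lemma essD X Y d d' : ess X d -> ess Y d' -> ess (X + Y) (d + d').
Proof.
move=> [F [fF h]] [G [fG k]]; exists (F + G); split.
  exact: (finite_rankD dot_norm).
by rewrite opprD addrACA (le_trans (opnorm_triangle _ _))// lerD.
Qed.

Lemma essN X d : ess X d -> ess (- X) d.
Proof.
move=> [F [fF h]]; exists (- F); split; first exact: (finite_rankN dot_norm).
by rewrite -opprD opnormN.
Qed.

Lemma essB X Y d d' : ess X d -> ess Y d' -> ess (X - Y) (d + d').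
Proof. by move=> hX /essN; exact: essD. Qed.

Lemma essMr X Y d : ess X d -> ess (X * Y) (d * opnorm Y).
Proof.
move=> [F [fF h]]; exists (F * Y); split; first exact: (finite_rankMr dot_norm).
by rewrite -mulrBl (le_trans (opnormM _ _))// ler_wpM2r ?opnorm_ge0.
Qed.

Lemma essMl X Y d : ess X d -> ess (Y * X) (opnorm Y * d).
Proof.
move=> [F [fF h]]; exists (Y * F); split; first exact: finite_rankMl.
by rewrite -mulrBr (le_trans (opnormM _ _))// ler_wpM2l ?opnorm_ge0.
Qed.

(** The approximant [P * X] given by [essP] has the explicit adjoint [Y * P], and passing to
    adjoints does not increase the norm. *)
Lemma ess_adj X Y d : adjoint dot X Y -> ess X d -> ess Y d.
Proof.
move=> XY /essP[s [pP h]]; exists (Y * diag_sum dot_norm s); split.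
  apply: finite_rankMl; rewrite -[diag_sum _ _]mulr1.
  exact: finite_rank_diag_sum.
apply: le_trans h; apply: (adj_norm dot_norm).
exact: adjB XY (adjM pP.2 XY).
Qed.

(** Norm limits of finite rank operators, identified with the compact operators in [compactP]. *)
Definition negligible X := forall e : R, 0 < e -> ess X e.

Lemma negligibleD X Y : negligible X -> negligible Y -> negligible (X + Y).
Proof.
move=> hX hY e e0; have e20 : 0 < e / 2 by rewrite divr_gt0.
by rewrite (splitr e); apply: essD; [exact: hX|exact: hY].
Qed.

Lemma negligibleN X : negligible X -> negligible (- X).
Proof. by move=> hX e /hX/essN. Qed.

Lemma negligible0 : negligible 0.
Proof.
by move=> e /ltW e0; apply: ess_finite_rank => //; exact: finite_rank0 dot_norm.
Qed.

Lemma negligible_le X C : 0 <= C ->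
  (forall e, 0 < e -> ess X (C * e)) -> negligible X.
Proof.
move=> C0 h e e0; have C1 : 0 < C + 1 by rewrite ltr_wpDl.
apply: ess_le (h (e / (C + 1)) _); last by rewrite divr_gt0.
by rewrite mulrA ler_pdivrMr// mulrDr mulr1 mulrC lerDl ltW.
Qed.

Lemma negligibleMr X Y : negligible X -> negligible (X * Y).
Proof.
move=> hX; apply: (@negligible_le _ (opnorm Y)) => [|e /hX h].
  exact: opnorm_ge0.
by rewrite mulrC; exact: essMr.
Qed.

Lemma negligibleMl X Y : negligible X -> negligible (Y * X).
Proof.
move=> hX; apply: (@negligible_le _ (opnorm Y)) => [|e /hX h].
  exact: opnorm_ge0.
exact: essMl.
Qed.

Lemma negligibleZ a X : negligible X -> negligible (a *: X).
Proof.
by move=> /(@negligibleMl _ (@GRing.scale _ (bop H) a (bop_one H)));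
  congr negligible; apply: bop_ext.
Qed.

Lemma negligible_adj X Y : adjoint dot X Y -> negligible X -> negligible Y.
Proof. by move=> XY hX e /hX/(ess_adj XY). Qed.

(** Cover the closed image of the unit ball by finitely many balls of radius [e] and let [P] project
    onto the span of the centres. As [P] fixes each centre [v], [X x - P (X x) = (1 - P) (X x - v)]
    has norm at most [e]. *)
Lemma compact_negligible X : compact_operator X -> negligible X.
Proof.
rewrite /compact_operator precompactE compact_cover => cX e e0.
have eC : 0 < e%:C by rewrite (@ltcR R 0).
have [|x _|D _ XD] := cX H setT (fun y => (ball y e%:C)).
- by move=> y _; exact: ball_open.
- by exists x => //; exact: ballxx.
have [s [pP fP _]] := proj_span dot_norm (finmap.enum_fset D).
set P := diag_sum dot_norm s in pP fP.
exists (P * X); split; first exact: finite_rank_diag_sum.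
apply: op_le_ball => x; rewrite -lecR -hnE => x1.
have [v vD Xv] : exists2 v, v \in finmap.enum_fset D & hn (X x - v) <= e.
  have [|v /= vD] := XD (X x); first by apply: subset_closure; exists x.
  by rewrite -ball_normE /= hnE ltcR hnC => /ltW ?; exists v.
apply: le_trans Xv.
have -> : (X - P * X) x = (1 - P) (X x - v).
  by rewrite bop_linB !bopB !bop1 bopM (fP v vD) subrr subr0.
exact (proj_hn dot_norm (X x - v) (projC pP)).
Qed.

End Essential.

(** * Compact operators as limits of finite rank operators *)

Section CompactOfNegligible.
Variables (R : realType) (H : completeNormedModType R[i]).
Variable dot : {dot H for @Num.conj R[i]}.
Hypothesis dot_norm : forall x : H, `|x| ^+ 2 = dot x x.

(** The image of the unit ball is within [e / 2] of its image under [diag_sum s * X], which lies in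
    a finite sum of totally bounded discs of multiples of the entries of [s]. *)
Lemma negligible_compact (X : bop H) : negligible X -> compact_operator X.
Proof.
move=> hX; apply: totally_bounded_precompact => e e0.
have e20 : 0 < e / 2 by rewrite divr_gt0.
have [s [pP h]] := essP dot_norm (hX _ e20).
have tb : totally_bounded
    [set (diag_sum dot_norm s * X) x | x in [set x : H | `|x| <= 1]].
  elim: s {pP h} => [|v s IH].
    rewrite /diag_sum big_nil mul0r => r r0; exists [:: 0] => _ [x _ <-].
    by exists 0; rewrite ?inE// bop0 subrr hn0 ltW.
  have := totally_boundedD (totally_bounded_disc v (opnorm X * hn v)) IH.
  apply: totally_boundedS => _ [x /= x1 <-].
  exists (dot (X x) v *: v).
    exists (dot (X x) v) => //=; rewrite (le_trans (cauchy_schwarz dot_norm _ _))//.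
    rewrite ler_wpM2r ?hn_ge0// (le_trans (le_op _ _))//.
    by rewrite ler_piMr ?opnorm_ge0// -lecR -hnE.
  exists ((diag_sum dot_norm s * X) x); first by exists x.
  by rewrite /diag_sum big_cons.
have [t tP] := tb _ e20; exists t => _ [x /= x1 <-].
have [|y yt hy] := tP ((diag_sum dot_norm s * X) x); first by exists x.
exists y => //; rewrite (le_trans (hn_trans ((diag_sum dot_norm s * X) x) _ _))//.
rewrite [leRHS](splitr e) lerD// -bopB (le_trans (le_op_trans _ h))//.
by rewrite ler_piMr ?(ltW e20)// -lecR -hnE.
Qed.

Lemma compactP (X : bop H) : compact_operator X <-> negligible X.
Proof.
by split; [exact: compact_negligible dot_norm _|exact: negligible_compact].
Qed.

End CompactOfNegligible.

(** * Geometrically convergent sequences and limits of operators and adjoints *)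

Lemma geometric_tail (R : realType) (V : normedModType R[i]) (C : R) (u : nat -> V) :
  (forall n, hn (u n.+1 - u n) <= C / 2 ^+ n) ->
  forall n m, (n <= m)%N -> hn (u m - u n) <= 2 * C / 2 ^+ n.
Proof.
move=> h; have C0 : 0 <= C.
  by have := h 0%N; rewrite expr0 divr1; apply: le_trans; exact: hn_ge0.
(* The telescoped bound, with [2 * C / 2 ^+ m] subtracted, is the one that induction on [m]
   preserves. *)
move=> n m nm; apply: (@le_trans _ _ (2 * C / 2 ^+ n - 2 * C / 2 ^+ m)); last first.
  by rewrite gerBl divr_ge0 ?mulr_ge0.
elim: m nm => [|m IH]; first by rewrite leqn0 => /eqP ->; rewrite !subrr hn0.
rewrite leq_eqVlt => /predU1P[->|]; first by rewrite !subrr hn0.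
rewrite ltnS => /IH {}IH; rewrite (le_trans (hn_trans (u m) _ _))//.
rewrite (le_trans (lerD (h m) IH))// exprS invfM.
by rewrite le_eqVlt; apply/orP; left; apply/eqP; field; rewrite ?expf_neq0.
Qed.

Section OperatorLimits.
Variables (R : realType) (H : completeNormedModType R[i]).
Variable dot : {dot H for @Num.conj R[i]}.
Hypothesis dot_norm : forall x : H, `|x| ^+ 2 = dot x x.
Implicit Types (x y z : H) (P Q S T X Y : bop H).
Notation adj := (adjoint dot).

Lemma bop_pointwise_limit (D : R) (u : nat -> bop H) (f : H -> H) :
  0 <= D -> (forall n, opnorm (u n) <= D) ->
  (forall x, (fun n => u n x) @ \oo --> f x) -> exists T : bop H, forall x, T x = f x.
Proof.
move=> D0 uD uf; have lf : linear f.
  move=> a x y.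
  have h : (fun n => u n (a *: x + y)) @ \oo --> a *: f x + f y.
    have -> : (fun n => u n (a *: x + y)) = (fun n => a *: u n x + u n y).
      by apply/funext => n; rewrite bop_linD bop_linZ.
    by apply: cvgD (uf y); exact: cvgZl_tmp (uf x).
  exact: cvg_unique (@norm_hausdorff _ H) _ _ _ _ (uf _) h.
have bf x : hn (f x) <= D * hn x.
  apply/ler_addgt0Pr => e e0.
  have [N /(_ N (leqnn N)) h] := (cvg_hnP _ _).1 (uf x) _ e0.
  have := hn_trans (u N x) (f x) 0; rewrite !subr0.
  have := le_op_trans x (uD N); lra.
have fB : f \in @bounded_linear R H.
  apply/bounded_linearP; split=> //; exists D => x.
  by rewrite !hnE -real_complexM lecR.
by exists (Bop fB).
Qed.

(** The limit is built pointwise from completeness of [H]; the tail estimates are uniform on the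
    unit ball, so they give boundedness and the rate of convergence in norm. *)
Lemma bop_complete (C : R) (u : nat -> bop H) :
  (forall n, opnorm (u n.+1 - u n) <= C / 2 ^+ n) ->
  exists T : bop H, forall n, opnorm (T - u n) <= 2 * C / 2 ^+ n.
Proof.
move=> h; have C0 : 0 <= C.
  by have := h 0%N; rewrite expr0 divr1; apply: le_trans; exact: opnorm_ge0.
have t n m (nm : (n <= m)%N) : opnorm (u m - u n) <= 2 * C / 2 ^+ n.
  exact: (@geometric_tail R (bop H) C u h n m nm).
have tx x n m : (n <= m)%N -> hn (u m x - u n x) <= (2 * C * hn x) / 2 ^+ n.
  move=> nm; rewrite -bopB (le_trans (le_op_trans _ (t _ _ nm)))//.
  by rewrite mulrAC.
have /choice[f fP] : forall x, exists y : H, (fun n => u n x) @ \oo --> y.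
  move=> x; apply: cauchy_hn_cvg => e e0.
  have [n nP] := geometric_lt (2 * C * hn x) e0.
  by exists n => m nm; rewrite (le_trans (tx _ _ _ nm))// ltW.
have [T Tf] : exists T : bop H, forall x, T x = f x.
  apply: (@bop_pointwise_limit (opnorm (u 0%N) + 2 * C) u) => //.
    by rewrite addr_ge0 ?opnorm_ge0 ?mulr_ge0.
  move=> n; rewrite -[u n](subrK (u 0%N)) addrC.
  rewrite (le_trans (opnorm_triangle _ _))// lerD2l.
  by have := t 0%N n isT; rewrite expr0 divr1.
exists T => n; apply: op_le => [|x]; first by rewrite divr_ge0 ?mulr_ge0.
by rewrite bopB Tf mulrAC; exact: cauchy_hn_lim (fP x) (tx x) n.
Qed.

(** Only the two vectors being tested need good approximations, so this covers strong limits such as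
    [adj_D] as well as norm limits. *)
Lemma adj_limit S T :
  (forall x y (e : R), 0 < e -> exists S' T',
     [/\ adj S' T', hn (S x - S' x) <= e & hn (T y - T' y) <= e]) -> adj S T.
Proof.
move=> h x y; apply/eqP; rewrite -subr_eq0 -normr_eq0.
pose C := hn x + hn y + 1.
have C0 : 0 < C by rewrite ltr_wpDl ?addr_ge0 ?hn_ge0.
suff : complex.Re `|dot (S x) y - dot x (T y)| <= 0.
  move=> r0; rewrite eq_le normr_ge0 andbT -[leLHS]RRe_real ?ger0_real//.
  by rewrite lecR.
apply/ler_addgt0Pr => e e0; rewrite add0r.
have [|S' [T' [ST' SS' TT']]] := h x y (e / C); first by rewrite divr_gt0.
have -> : dot (S x) y - dot x (T y) = dot (S x - S' x) y - dot x (T y - T' y).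
  by rewrite dotBl dotBr ST'; ring.
apply: (@le_trans _ _ (complex.Re `|dot (S x - S' x) y| +
    complex.Re `|dot x (T y - T' y)|)).
  rewrite -lecR real_complexD !RRe_real ?ger0_real//.
  by rewrite ler_normB.
apply: (@le_trans _ _ (e / C * hn y + hn x * (e / C))).
  apply: lerD; apply: le_trans (cauchy_schwarz dot_norm _ _) _.
    by rewrite ler_wpM2r ?hn_ge0.
  by rewrite ler_wpM2l ?hn_ge0.
rewrite [hn x * _]mulrC -mulrDr mulrAC ler_pdivrMr// ler_wpM2l ?(ltW e0)//.
by rewrite /C [hn y + _]addrC lerDl.
Qed.

(** By [adj_norm], adjoints of a fast convergent sequence converge equally fast; their limit is the
    adjoint of [S]. *)
Lemma adjointable_closed S :
  (forall e : R, 0 < e -> exists S' T', adj S' T' /\ opnorm (S - S') <= e) ->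
  exists T, adj S T.
Proof.
move=> h; have /choice[u uP] : forall n, exists U : bop H * bop H,
    adj U.1 U.2 /\ opnorm (S - U.1) <= 1 / 2 ^+ n.
  move=> n; have [|S' [T' h']] := h (1 / 2 ^+ n); first by rewrite divr_gt0.
  by exists (S', T').
have [|T TP] := @bop_complete 2 (fun n => (u n).2).
  move=> n; rewrite (le_trans (adj_norm dot_norm (adjB (uP n.+1).1 (uP n).1)))//.
  rewrite (le_trans (opnorm_dist_triangle S _ _))// opnormB_sym.
  rewrite (le_trans (lerD (uP n.+1).2 (uP n).2))//.
  have -> : 2 / 2 ^+ n = 1 / 2 ^+ n + 1 / 2 ^+ n :> R by ring.
  rewrite lerD2r ler_pM2l// lef_pV2 ?posrE ?exprn_gt0//.
  by rewrite exprS ler_peMl ?exprn_ge0// ler1n.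
exists T; apply: adj_limit => x y e e0.
have [n nP] := geometric_lt (4 * hn x + 4 * hn y) e0.
have k0 : 0 <= (2 ^+ n)^-1 :> R by rewrite invr_ge0 exprn_ge0.
rewrite mulrDl in nP.
have x0 : 0 <= hn x * (2 ^+ n)^-1 by rewrite mulr_ge0 ?hn_ge0.
have y0 : 0 <= hn y * (2 ^+ n)^-1 by rewrite mulr_ge0 ?hn_ge0.
exists (u n).1, (u n).2; split; first exact: (uP n).1.
  by have := le_op_trans x (uP n).2; rewrite bopB; lra.
by have := le_op_trans y (TP n); rewrite bopB; lra.
Qed.

End OperatorLimits.

(** * Truncation modulo compact operators and closedness of A + K(H) *)

Section CompactPerturbations.
Variables (R : realType) (H : completeNormedModType R[i]).
Variable dot : {dot H for @Num.conj R[i]}.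
Hypothesis dot_norm : forall x : H, `|x| ^+ 2 = dot x x.
Implicit Types (x y z : H) (P Q S T X Y : bop H).
Notation adj := (adjoint dot).

(* Y is meant to be the adjoint of X *)
Definition shrink (M : R) X Y : bop H := X - (M ^- 2)%:C *: (X * (Y * X)).

(** Expanding the square, the cross term is [- 2 * M ^- 2 * hn (Y v) ^+ 2], and [opnorm X <= M] lets
    the last term cancel at most half of it. At [v = X x] the vector on the left is
    [shrink M X Y x]. *)
Lemma shrink_vec (M : R) X Y v : 0 < M -> adj X Y -> opnorm X <= M ->
  hn (v - (M ^- 2)%:C *: X (Y v)) ^+ 2 <= hn v ^+ 2 - M ^- 2 * hn (Y v) ^+ 2.
Proof.
move=> M0 XY XM; rewrite (hnB_sqr dot_norm) hnZ.
have c0 : 0 < M ^- 2 by rewrite invr_gt0 exprn_gt0.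
have -> : complex.Re `|(M ^- 2)%:C| = M ^- 2.
  by rewrite ger0_norm ?ler0c ?(ltW c0).
have -> : complex.Re (dot v ((M ^- 2)%:C *: X (Y v))) = M ^- 2 * hn (Y v) ^+ 2.
  rewrite dotZr -(adj_sym XY) -(hn_sqr dot_norm).
  have -> : ((M ^- 2)%:C)^*%R = (M ^- 2)%:C by apply/CrealP; rewrite complex_real.
  by rewrite -real_complexM.
have h : hn (X (Y v)) <= M * hn (Y v) by exact: le_op_trans.
have h2 : hn (X (Y v)) ^+ 2 <= M ^+ 2 * hn (Y v) ^+ 2.
  by rewrite -exprMn ler_pXn2r// ?nnegrE ?mulr_ge0 ?hn_ge0 ?(ltW M0).
rewrite exprMn; have : (M ^- 2) ^+ 2 * hn (X (Y v)) ^+ 2 <= M ^- 2 * hn (Y v) ^+ 2.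
  rewrite expr2 -mulrA ler_pM2l// mulrC ler_pdivrMr ?exprn_gt0//.
  by rewrite mulrC.
lra.
Qed.

(** With [a = hn (Y (X x))] and [b = hn x], Cauchy-Schwarz bounds [hn (X x) ^+ 2] by [b * a], and
    [b * a - M ^- 2 * a ^+ 2] is at most [M ^+ 2 * b ^+ 2 / 4] by completing the square. *)
Lemma shrink_half M X Y : 0 < M -> adj X Y -> opnorm X <= M ->
  opnorm (shrink M X Y) <= M / 2.
Proof.
move=> M0 XY XM; apply: op_le => [|x]; first by rewrite divr_ge0 ?(ltW M0).
rewrite -(@ler_pXn2r _ 2)// ?nnegrE ?mulr_ge0 ?hn_ge0 ?divr_ge0 ?(ltW M0)//.
rewrite bopB bopZ !bopM (le_trans (shrink_vec _ M0 XY XM))//.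
have h : hn (X x) ^+ 2 <= hn x * hn (Y (X x)).
  by rewrite (hn_sqrE dot_norm) XY (Re_dot_le dot_norm).
set a := hn (Y (X x)) in h *; set b := hn x in h *.
have -> : (M / 2 * b) ^+ 2 = M ^+ 2 * b ^+ 2 / 4 by field.
have : 0 <= (a / M - M * b / 2) ^+ 2 by exact: sqr_ge0.
have -> : (a / M - M * b / 2) ^+ 2 = M ^- 2 * a ^+ 2 - b * a + M ^+ 2 * b ^+ 2 / 4.
  by field; rewrite gt_eqF.
lra.
Qed.

Lemma shrink_le M X Y : 0 < M -> adj X Y -> opnorm X <= M ->
  opnorm (shrink M X Y) <= opnorm X.
Proof.
move=> M0 XY XM; apply: op_le => [|x]; first exact: opnorm_ge0.
apply: le_trans (le_op X x).
rewrite -(@ler_pXn2r _ 2)// ?nnegrE ?hn_ge0//.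
rewrite bopB bopZ !bopM (le_trans (shrink_vec _ M0 XY XM))//.
by rewrite gerBl mulr_ge0 ?sqr_ge0// invr_ge0 exprn_ge0// ltW.
Qed.

Lemma finite_rank_mul_congr S S' T T' : finite_rank (S - S') ->
  finite_rank (T - T') -> finite_rank (S * T - S' * T').
Proof.
move=> fS fT; have -> : S * T - S' * T' = (S - S') * T + S' * (T - T').
  by rewrite mulrBl mulrBr addrA subrK.
apply: finite_rankD => //; first exact: (finite_rankMr dot_norm).
exact: finite_rankMl.
Qed.

Lemma finite_rankZ a S : finite_rank S -> finite_rank (a *: S).
Proof.
move=> fS; have -> : a *: S = @GRing.scale _ (bop H) a (bop_one H) * S.
  exact: bop_ext.
exact: finite_rankMl.
Qed.

(** Modulo finite rank, [X] may be replaced by [Z = X - P * X], of norm at most [d], since [shrink]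
    is a polynomial in the operator and its adjoint. For [Z] both bounds are plain norm
    estimates. *)
Lemma ess_shrink M d X Y : 0 < M -> d <= M -> adj X Y -> ess X d ->
  ess (shrink M X Y) d /\ ess (X - shrink M X Y) (d ^+ 3 / M ^+ 2).
Proof.
move=> M0 dM XY /(essP dot_norm)[s [pP h]]; set P := diag_sum _ s in pP h.
have fP : finite_rank P.
  by rewrite -[P]mulr1; exact: finite_rank_diag_sum.
set Z := X - P * X in h; set W := Y - Y * P.
have ZW : adj Z W by exact: adjB XY (adjM pP.2 XY).
have fZ : finite_rank (X - Z) by rewrite subKr; exact: finite_rankMr.
have fW : finite_rank (Y - W) by rewrite subKr; exact: finite_rankMl.
have fC : finite_rank ((M ^- 2)%:C *: (X * (Y * X) - Z * (W * Z))).
  by apply: finite_rankZ; do 2 apply: finite_rank_mul_congr => //.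
have ZM : opnorm Z <= M := le_trans h dM.
have d0 : 0 <= d := le_trans (opnorm_ge0 Z) h.
split.
  exists (shrink M X Y - shrink M Z W); split.
    have -> : shrink M X Y - shrink M Z W =
        (X - Z) - (M ^- 2)%:C *: (X * (Y * X) - Z * (W * Z)).
      by rewrite /shrink scalerBr !opprD addrACA.
    apply: finite_rankD => //; exact: (finite_rankN dot_norm).
  by rewrite subKr (le_trans (shrink_le M0 ZW ZM)).
exists ((M ^- 2)%:C *: (X * (Y * X) - Z * (W * Z))); split=> //.
rewrite /shrink subKr -scalerBr subKr.
rewrite -lecR opnormZ ger0_norm ?ler0c ?invr_ge0 ?exprn_ge0 ?(ltW M0)//.
rewrite -real_complexM lecR mulrC ler_wpM2r ?invr_ge0 ?exprn_ge0 ?(ltW M0)//.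
have Wd : opnorm W <= d := le_trans (adj_norm dot_norm ZW) h.
rewrite (le_trans (opnormM _ _))// exprS ler_pM ?opnorm_ge0//.
by rewrite (le_trans (opnormM _ _))// expr2 ler_pM ?opnorm_ge0.
Qed.

Variable A : set (bop H).
Hypothesis A_cstar : cstar_algebra dot A.

Lemma cstarB S T : A S -> A T -> A (S - T).
Proof.
have [[_ AD AZ] _ _ _] := A_cstar.
by move=> AS AT; apply: (AD) => //; rewrite -scaleN1r; exact: AZ.
Qed.

Lemma cstar_limit S :
  (forall e : R, 0 < e -> exists2 T, A T & opnorm (S - T) <= e) -> A S.
Proof.
move=> h; have [_ _ _ Acl] := A_cstar; apply: Acl; apply/closure_hnP => e /h.
by case=> T AT ST; exists T.
Qed.

(** Each application of [shrink] halves the norm bound. At [M = 2 * d * 2 ^+ j] the error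
    [d ^+ 3 / M ^+ 2] is [d / 4 * 4 ^- j]; summing over [j] from 1 to [k] gives the stated geometric
    sum. *)
Lemma ess_truncate k d X : 0 < d -> A X -> opnorm X <= 2 * d * 2 ^+ k ->
  ess X d -> exists Y, [/\ A Y, opnorm Y <= 2 * d
    & ess (X - Y) (d / 12 * (1 - 4 ^- k))].
Proof.
move=> d0; have [[_ AD AZ] AM Aadj _] := A_cstar.
elim: k X => [|k IH] X AX XM Xd.
  exists X; split=> //; first by rewrite expr0 mulr1 in XM.
  by rewrite subrr expr0 invr1 subrr mulr0; apply: ess_opnorm => //; rewrite opnorm0.
set M := 2 * d * 2 ^+ k.+1 in XM.
have k1 : 1 <= 2 ^+ k.+1 :> R by rewrite exprn_ege1// ler1n.
have M0 : 0 < M by rewrite !mulr_gt0 ?exprn_gt0.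
have dM : d <= M by rewrite /M; nra.
have [Y AY XY] := Aadj _ AX.
have [sd sXd] := ess_shrink M0 dM XY Xd.
have [| |Z [AZ' Zd XZ]] := IH (shrink M X Y) _ _ sd.
- by apply: cstarB => //; apply: (AZ); apply: (AM) => //; exact: AM.
- rewrite (le_trans (shrink_half M0 XY XM))// /M exprS.
  by rewrite le_eqVlt; apply/orP; left; apply/eqP; field.
exists Z; split=> //.
have -> : X - Z = (X - shrink M X Y) + (shrink M X Y - Z) by rewrite addrA subrK.
have -> : d / 12 * (1 - 4 ^- k.+1) = d ^+ 3 / M ^+ 2 + d / 12 * (1 - 4 ^- k).
  have -> : M ^+ 2 = 4 * d ^+ 2 * 4 ^+ k.+1.
    by rewrite /M !exprMn -exprM mulnC exprM -!natrX.
  rewrite exprS; field; rewrite expf_neq0//= gt_eqF//.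
exact: essD.
Qed.

(* A + K(H) is closed. Successive approximation: the error of the current T is
   halved by adding to T the truncation (ess_truncate) of T0 - T, for some
   T0 in A that is close to S modulo K(H). *)
Lemma cstar_add_compact_closed S :
  (forall e : R, 0 < e -> exists S' T,
     [/\ A T, negligible (S' - T) & opnorm (S - S') <= e]) ->
  exists2 T, A T & negligible (S - T).
Proof.
move=> h; have [[A0 AD _] _ _ _] := A_cstar.
(* Choose [T0] in [A] with [S - T0] of essential size [d / 4]; then [T0 - T] has essential size at
   most [2 * d]. Truncating at level [2 * d] gives [Y] of norm at most [4 * d] with error at most
   [2 * d / 12 <= d / 4], so the total is [d / 2]. *)
have step d T : 0 < d -> A T -> ess (S - T) d ->
    exists T', [/\ A T', ess (S - T') (d / 2) & opnorm (T' - T) <= 4 * d].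
  move=> d0 AT STd; have d8 : 0 < d / 8 by rewrite divr_gt0.
  have [S0 [T0 [AT0 ST0 SS0]]] := h _ d8.
  have e0 : ess (S - T0) (d / 4).
    have -> : S - T0 = (S - S0) + (S0 - T0) by rewrite addrA subrK.
    have -> : d / 4 = d / 8 + d / 8 by field.
    by apply: essD => //; [exact: ess_opnorm|exact: ST0].
  have e1 : ess (T0 - T) (2 * d).
    have -> : T0 - T = (S - T) - (S - T0) by rewrite opprB [RHS]addrC addrA subrK.
    by apply: ess_le (essB dot_norm STd e0); lra.
  have d2 : 0 < 2 * d by rewrite mulr_gt0.
  have [k kP] := geometric_lt (opnorm (T0 - T)) (mulr_gt0 (ltr0n R 2) d2).
  rewrite ltr_pdivrMr ?exprn_gt0// in kP.
  have [Y [AY Yd e2]] := ess_truncate d2 (cstarB AT0 AT) (ltW kP) e1.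
  exists (T + Y); split; first exact: AD.
    have -> : S - (T + Y) = (S - T0) + (T0 - T - Y).
      by rewrite opprD !addrA subrK.
    have -> : d / 2 = d / 4 + d / 4 by field.
    apply: (essD dot_norm e0); apply: ess_le e2.
    have : 0 <= 4 ^- k :> R by rewrite invr_ge0 exprn_ge0.
    nra.
  by rewrite addrC addKr; lra.
(* The iteration starts at 0, where the error is [S] itself; the added 1 makes the initial bound
   positive. *)
pose d0 := opnorm S + 1.
have d00 : 0 < d0 by rewrite ltr_wpDl ?opnorm_ge0.
have dn n : 0 < d0 / 2 ^+ n by rewrite divr_gt0 ?exprn_gt0.
have /choice[f fP] : forall nT : nat * bop H, exists T',
    A nT.2 -> ess (S - nT.2) (d0 / 2 ^+ nT.1) ->
    [/\ A T', ess (S - T') (d0 / 2 ^+ nT.1.+1)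
      & opnorm (T' - nT.2) <= 4 * d0 / 2 ^+ nT.1].
  move=> [n T]/=; have [[AT eT]|nT] := pselect (A T /\ ess (S - T) (d0 / 2 ^+ n)).
    have [T' [AT' eT' dT']] := step _ _ (dn n) AT eT; exists T' => _ _; split=> //.
      by rewrite exprSr invfM mulrA.
    by rewrite -mulrA.
  by exists 0 => AT eT; case: nT.
pose T_ := fix T_ n := if n is m.+1 then f (m, T_ m) else 0 : bop H.
have TP n : A (T_ n) /\ ess (S - T_ n) (d0 / 2 ^+ n).
  elim: n => [|n [IH1 IH2]].
    split=> //=; rewrite subr0 expr0 divr1.
    by apply: ess_opnorm => //; rewrite /d0 lerDl.
  by have [] := fP (n, T_ n) IH1 IH2.
have [n|T Tlim] := @bop_complete _ _ (4 * d0) T_.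
  by have [] := fP (n, T_ n) (TP n).1 (TP n).2.
exists T.
  apply: cstar_limit => e e0; have [n nP] := geometric_lt (2 * (4 * d0)) e0.
  by exists (T_ n); [exact: (TP n).1|rewrite (le_trans (Tlim n))// ltW].
move=> e e0; have [n nP] := geometric_lt (d0 + 2 * (4 * d0)) e0.
apply: ess_le (ltW nP) _.
have -> : S - T = (S - T_ n) - (T - T_ n) by rewrite opprB addrA subrK.
rewrite mulrDl; apply: essB => //; first exact: (TP n).2.
exact: ess_opnorm.
Qed.

End CompactPerturbations.

(** * Perturbed projections and an increasing quasidiagonal sequence *)

Lemma le_sum_mem (R : numDomainType) (T : eqType) (s : seq T) (f : T -> R) t :
  (forall x, 0 <= f x) -> t \in s -> f t <= \sum_(x <- s) f x.
Proof.
move=> f0; elim: s => // a s IH; rewrite inE big_cons => /predU1P[->|/IH h].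
  by rewrite lerDl sumr_ge0.
by rewrite (le_trans h)// lerDr.
Qed.

Section Projections.
Variables (R : realType) (H : completeNormedModType R[i]).
Variable dot : {dot H for @Num.conj R[i]}.
Hypothesis dot_norm : forall x : H, `|x| ^+ 2 = dot x x.
Implicit Types (x y z : H) (P Q S T X Y : bop H).
Notation adj := (adjoint dot).

Definition fin_proj P := projection dot P /\ finite_rank P.

(* P = Q + P' - G where G is the projection onto the range of P'Q *)
Lemma proj_perturb P' Q (e : R) : fin_proj P' -> fin_proj Q ->
  e <= 1 / 2 -> opnorm (Q - P' * Q) <= e ->
  exists P, [/\ fin_proj P, P * Q = Q & opnorm (P - P') <= 3 * e].
Proof.
move=> [pP' fP'] [pQ fQ] e2 h; have [n [w wQ]] := fQ.
have [t [pG fG VG]] := proj_span dot_norm [seq P' (Q (w i)) | i : 'I_n].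
set G := diag_sum dot_norm t in pG fG VG.
have e0 : 0 <= e := le_trans (opnorm_ge0 _) h.
have GPQ : G * (P' * Q) = P' * Q.
  apply: bop_ext => x; rewrite !bopM -(projK x pQ).
  have [c ->] := wQ x; rewrite !bop_lin_sum; apply: eq_bigr => i _.
  by rewrite !bop_linZ fG// fintype.image_f.
have Gx x : exists z, G x = P' (Q z).
  apply: (VG [set y | exists z, y = P' (Q z)]).
    split=> [|y z [y' ->] [z' ->]|a y [y' ->]]; first by exists 0; rewrite !bop_lin0.
      by exists (y' + z'); rewrite !bop_linD.
    by exists (a *: y'); rewrite !bop_linZ.
  by move=> v /mapP[i _ ->]; exists (w i).
have PG : P' * G = G.
  by apply: bop_ext => x; rewrite bopM; have [z ->] := Gx x; exact (projK (Q z) pP').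
have GP : G * P' = G.
  apply: (adj_inj dot_norm _ pG.2); rewrite -{1}PG; exact: adjM pP'.2 pG.2.
have GQ : G * Q = P' * Q by rewrite -GPQ mulrA GP.
have QG : Q * G = Q * P'.
  have a1 : adj (G * Q) (Q * G) := adjM pG.2 pQ.2.
  rewrite GQ in a1; exact: (adj_inj dot_norm a1 (adjM pP'.2 pQ.2)).
(* [P' - G] is a projection because [P' * G = G = G * P'], and [G * Q = P' * Q] says that it is
   orthogonal to [Q]. *)
exists (Q + P' - G); split.
- split.
    split; last by apply: adjB pG.2; exact: adjD pQ.2 pP'.2.
    rewrite mulrBl mulrDl !mulrBr !mulrDr pQ.1 QG pP'.1 PG GQ GP pG.1.
    rewrite (addrK (Q * P')) (addrK G) -[P' * Q + P' - G]addrA.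
    by rewrite [P' * Q + (P' - G)]addrC addrA (addrK (P' * Q)) addrA.
  apply: finite_rankD => //; first exact: finite_rankD.
  apply: (finite_rankN dot_norm); rewrite -[G]mulr1; exact: finite_rank_diag_sum.
- by rewrite mulrBl mulrDl pQ.1 GQ addrK.
(* The first difference is [Q - P' * Q], of norm at most [e]; the second is estimated through its
   adjoint [G - Q * G] by [2 * e]. *)
have -> : Q + P' - G - P' = (Q - G * Q) - (G - G * Q).
  by rewrite opprB addrA subrK addrAC addrK.
rewrite (le_trans (opnormB _ _))//; have -> : 3 * e = e + 2 * e by ring.
apply: lerD; first by rewrite GQ.
apply: (@le_trans _ _ (opnorm (G - Q * G))).
  apply: (adj_norm dot_norm); apply: adjB pG.2 _; exact: adjM pQ.2 pG.2.
apply: op_le => [|x]; first by rewrite mulr_ge0.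
(* Here [G x = P' (Q z)] is within [e * hn (Q z)] of [Q z], a vector in the range of [Q]. Since
   [e <= 1 / 2], [hn (Q z) <= 2 * hn (G x)]. *)
rewrite bopB bopM; have [z Gz] := Gx x.
have d1 : hn (Q z - G x) <= e * hn (Q z).
  by have := le_op_trans (Q z) h; rewrite bopB bopM !(projK z pQ) Gz.
have d2 : hn (G x - Q (G x)) <= hn (Q z - G x).
  have -> : G x - Q (G x) = (1 - Q) (G x - Q z).
    by rewrite bop_linB !bopB !bop1 (projK z pQ) subrr subr0.
  by rewrite [leRHS]hnC; exact (proj_hn dot_norm _ (projC pQ)).
have d3 : hn (Q z) <= hn (Q z - G x) + hn (G x).
  by have := hn_trans (G x) (Q z) 0; rewrite !subr0.
have d4 := proj_hn dot_norm x pG.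
have d5 : e * hn (Q z) <= 1 / 2 * hn (Q z) by rewrite ler_wpM2r ?hn_ge0.
have d6 : e * hn (Q z) <= e * (2 * hn x) by rewrite ler_wpM2l//; lra.
lra.
Qed.

Variable A : set (bop H).
Hypothesis A_qd : quasidiagonal_set dot A.

(** Apply quasidiagonality with the vectors spanning the range of [Q] added to [t]. The resulting
    [P'] nearly fixes the range of [Q], and [proj_perturb] then moves it slightly to lie above
    [Q]. *)
Lemma quasidiagonal_above Q (s : seq (bop H)) (t : seq H) (e : R) :
  fin_proj Q -> (forall T, T \in s -> A T) -> 0 < e ->
  exists P, [/\ fin_proj P, P * Q = Q,
    forall T, T \in s -> opnorm (T * P - P * T) <= e &
    forall x, x \in t -> hn (P x - x) <= e].
Proof.
move=> Qf sA e0; have [v [pv vQ]] := finite_rankP dot_norm Qf.2.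
pose M := \sum_(T <- s) opnorm T; pose N := \sum_(x <- t) hn x.
pose L := \sum_(x <- v) hn x.
have M0 : 0 <= M by apply: sumr_ge0 => *; exact: opnorm_ge0.
have N0 : 0 <= N by apply: sumr_ge0 => *; exact: hn_ge0.
have L0 : 0 <= L by apply: sumr_ge0 => *; exact: hn_ge0.
(* Moving [P'] by [3 * d] adds at most [6 * d * M] to each commutator and [3 * d * N] to the error
   on each vector. Both fit when [d * K <= e], and [d * K <= 1] gives the [d <= 1 / 2] wanted by
   [proj_perturb]. *)
pose K := 2 * (6 * M + 3 * N + 1).
have K0 : 0 < K by rewrite /K; lra.
pose d := Num.min e 1 / K.
have m0 : 0 < Num.min e 1 by rewrite lt_min e0 ltr01.
have d0 : 0 < d by rewrite divr_gt0.
have dK : d * K = Num.min e 1 by rewrite /d divfK// gt_eqF.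
have me : Num.min e 1 <= e by rewrite ge_min lexx.
have m1 : Num.min e 1 <= 1 by rewrite ge_min lexx orbT.
have dM : 0 <= d * M by rewrite mulr_ge0// ltW.
have dN : 0 <= d * N by rewrite mulr_ge0// ltW.
have L1 : 0 < L + 1 by rewrite ltr_wpDl.
have r0 : 0 < d / (L + 1) by rewrite divr_gt0.
have rd : d / (L + 1) <= d by rewrite ler_pdivrMr// ler_peMr ?(ltW d0)// lerDr.
have [P' [pP' fP' cP' xP']] := A_qd (finite_seq s) sA (finite_seq (v ++ t)) r0.
have cP T : T \in s -> opnorm (T * P' - P' * T) <= d.
  by move=> /cP'; rewrite bop_normE lecR => /le_trans; apply.
have hP x : x \in v ++ t -> hn (P' x - x) <= d / (L + 1).
  by move=> /xP'; rewrite hnE lecR.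
have QP : opnorm (Q - P' * Q) <= d.
  (* Expanding [Q = diag_sum v * Q] turns closeness on the entries of [v] into a norm bound. The
     tolerance [d / (L + 1)] per vector sums to at most [d]. *)
  have -> : Q - P' * Q = \sum_(x <- v) rank1 dot_norm (x - P' x) (Q x).
    apply: bop_ext => y; rewrite bopB bopM -{1 2}vQ bopM !bop_sum.
    rewrite bop_lin_sum -sumrB; apply: eq_bigr => x _.
    by rewrite !rank1E -Qf.1.2 bop_linZ scalerBr.
  apply: (@le_trans _ _ (\sum_(x <- v) opnorm (rank1 dot_norm (x - P' x) (Q x)))).
    exact: (@hn_sum R (bop H) _ v (fun x => rank1 dot_norm (x - P' x) (Q x))).
  apply: (@le_trans _ _ (\sum_(x <- v) (d / (L + 1)) * hn x)).
    rewrite big_seq [leRHS]big_seq; apply: ler_sum => x xv.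
    rewrite (le_trans (opnorm_rank1 _ _ _))//.
    rewrite ler_pM ?hn_ge0// ?(proj_hn dot_norm _ Qf.1)//.
    by rewrite hnC hP// mem_cat xv.
  rewrite -mulr_sumr mulrAC ler_pdivrMr// ler_wpM2l ?(ltW d0)//.
  by rewrite lerDl.
have [|P [Pf PQ PP']] := proj_perturb (conj pP' fP') Qf _ QP.
  by move: dK; rewrite /K; nra.
exists P; split=> // [T Ts|x xt].
  have -> : T * P - P * T = (T * P' - P' * T) + (T * (P - P') - (P - P') * T).
    rewrite mulrBr mulrBl (opprD (P * T)) [T * P - _ + _]addrACA.
    by rewrite -(opprD (T * P')) [RHS]addrC subrK.
  have TM : opnorm T <= M by exact: (le_sum_mem (@opnorm_ge0 R H)).
  have h1 := opnormM T (P - P'); have h2 := opnormM (P - P') T.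
  have h3 := opnormB (T * (P - P')) ((P - P') * T).
  have h4 := opnorm_triangle (T * P' - P' * T) (T * (P - P') - (P - P') * T).
  have h5 : opnorm T * opnorm (P - P') <= M * (3 * d).
    by rewrite ler_pM ?opnorm_ge0.
  have h6 := cP _ Ts; rewrite [opnorm (P - P') * _]mulrC in h2.
  by move: dK; rewrite /K; lra.
have -> : P x - x = (P' x - x) + (P - P') x by rewrite bopB [RHS]addrC addrA subrK.
have xN : hn x <= N by exact: (le_sum_mem (@hn_ge0 R H)).
have h1 := hnD (P' x - x) ((P - P') x).
have h2 := le_op_trans x PP'.
have h3 : 3 * d * hn x <= 3 * d * N by rewrite ler_wpM2l// mulr_ge0// ltW.
have h4 : hn (P' x - x) <= d by rewrite (le_trans _ rd)// hP// mem_cat xt orbT.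
by move: dK; rewrite /K; lra.
Qed.

(** Iterate [quasidiagonal_above] from [P 0 = 0], adding one more operator [T_ k] and one more
    vector [xi k] at each step. The bound for [s] also holds at index 0, where the commutators
    vanish. *)
Lemma quasidiagonal_sequence (T_ : nat -> bop H) (xi : nat -> H)
    (s : seq (bop H)) (e : R) :
  (forall n, A (T_ n)) -> (forall T, T \in s -> A T) -> 0 < e ->
  exists P : nat -> bop H,
    [/\ P 0%N = 0, forall n, fin_proj (P n), forall n, P n.+1 * P n = P n &
     [/\ forall n T, T \in s -> opnorm (T * P n - P n * T) <= e / 2 ^+ n,
         forall k n, (k < n)%N -> opnorm (T_ k * P n - P n * T_ k) <= e / 2 ^+ n &
         forall k n, (k < n)%N -> hn (P n (xi k) - xi k) <= e / 2 ^+ n]].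
Proof.
move=> AT As e0.
have en n : 0 < e / 2 ^+ n by rewrite divr_gt0 ?exprn_gt0.
have /choice[f fP] : forall nQ : nat * bop H, exists P, fin_proj nQ.2 ->
    [/\ fin_proj P, P * nQ.2 = nQ.2,
     forall T, T \in s ++ [seq T_ k | k <- iota 0 nQ.1.+1] ->
       opnorm (T * P - P * T) <= e / 2 ^+ nQ.1.+1 &
     forall x, x \in [seq xi k | k <- iota 0 nQ.1.+1] ->
       hn (P x - x) <= e / 2 ^+ nQ.1.+1].
  (* The value 0 is a filler for inputs that are not finite rank projections; the recursion never
     meets them. *)
  move=> [n Q]; have [Qf|nQ] := pselect (fin_proj Q); last by exists 0.
  have [|P h] := @quasidiagonal_above Q (s ++ [seq T_ k | k <- iota 0 n.+1])
    [seq xi k | k <- iota 0 n.+1] _ Qf _ (en n.+1); last by exists P.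
  by move=> T; rewrite mem_cat => /orP[/As//|/mapP[k _ ->]].
pose P := fix P n := if n is m.+1 then f (m, P m) else 0 : bop H.
have PF n : fin_proj (P n).
  elim: n => [|n IH]; last by have [] := fP (n, P n) IH.
  by split; [exact: proj0|exact: finite_rank0 dot_norm].
exists P; split=> // [n|]; first by have [] := fP (n, P n) (PF n).
split=> [[|n] T Ts|k [//|n] kn|k [//|n] kn].
- by rewrite mulr0 mul0r subrr opnorm0 ltW.
- by have [_ _ + _] := fP (n, P n) (PF n); apply; rewrite mem_cat Ts.
- have [_ _ + _] := fP (n, P n) (PF n); apply; rewrite mem_cat map_f ?orbT//.
  by rewrite mem_iota.
- have [_ _ _] := fP (n, P n) (PF n); apply; rewrite map_f//.
  by rewrite mem_iota.
Qed.

End Projections.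

(** * Compression to the diagonal blocks *)

Lemma subrACA (V : zmodType) (a b c d : V) : (a - b) - (c - d) = (a - c) - (b - d).
Proof. by rewrite (opprD c) (opprD b) addrACA. Qed.

Section BlockDiagonal.
Variables (R : realType) (H : completeNormedModType R[i]).
Variable dot : {dot H for @Num.conj R[i]}.
Hypothesis dot_norm : forall x : H, `|x| ^+ 2 = dot x x.
Implicit Types (x y z : H) (Q S T X Y : bop H).
Notation adj := (adjoint dot).
Variable P : nat -> bop H.
Hypothesis P0 : P 0%N = 0.
Hypothesis P_proj : forall n, fin_proj dot (P n).
Hypothesis P_mono : forall n, P n.+1 * P n = P n.
Hypothesis P_lim : forall x (e : R), 0 < e ->
  exists N, forall n, (N <= n)%N -> hn (x - P n x) <= e.

Lemma P_mul_le m n : (m <= n)%N -> P n * P m = P m.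
Proof.
elim: n => [|n IH]; first by rewrite leqn0 => /eqP ->; exact: (P_proj 0).1.1.
rewrite leq_eqVlt => /predU1P[->|]; first exact: (P_proj n.+1).1.1.
by rewrite ltnS => /IH PmE; rewrite -PmE mulrA P_mono.
Qed.

Lemma P_mul_ge m n : (m <= n)%N -> P m * P n = P m.
Proof.
move=> /P_mul_le h; have := adjM (P_proj n).1.2 (P_proj m).1.2.
by rewrite h => /(adj_inj dot_norm (P_proj m).1.2)/esym.
Qed.

Definition block n : bop H := P n.+1 - P n.

Lemma block_proj n : projection dot (block n).
Proof.
split; last exact: adjB (P_proj _).1.2 (P_proj _).1.2.
rewrite /block mulrBl !mulrBr (P_proj n.+1).1.1 P_mono P_mul_ge//.
by rewrite (P_proj n).1.1 subrr subr0.
Qed.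

Lemma P_block m n : (m <= n)%N -> P m * block n = 0.
Proof. by move=> mn; rewrite mulrBr !P_mul_ge ?subrr// (leq_trans mn). Qed.

Lemma block_P m n : (m <= n)%N -> block n * P m = 0.
Proof. by move=> mn; rewrite mulrBl !P_mul_le ?subrr// (leq_trans mn). Qed.

Lemma P_block_id m n : (n < m)%N -> P m * block n = block n.
Proof. by move=> nm; rewrite mulrBr !P_mul_le// ltnW. Qed.

Lemma block_P_id m n : (n < m)%N -> block n * P m = block n.
Proof. by move=> nm; rewrite mulrBl !P_mul_ge// ltnW. Qed.

Fixpoint dsum T n : bop H :=
  if n is m.+1 then dsum T m + block m * T * block m else 0.

Lemma dsum_P_id T m n : (m <= n)%N -> dsum T m * P n = dsum T m.
Proof.
elim: m => [|m IH] /= mn; first by rewrite mul0r.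
by rewrite mulrDl IH ?(ltnW mn)// -mulrA block_P_id.
Qed.

Lemma dsumP T m n : (m <= n)%N -> dsum T n * P m = dsum T m.
Proof.
elim: n => [|n IH]; first by rewrite leqn0 => /eqP ->; rewrite mul0r.
rewrite leq_eqVlt => /predU1P[->|]; first exact: dsum_P_id.
by rewrite ltnS => h /=; rewrite mulrDl -mulrA block_P// mulr0 addr0 IH.
Qed.

Lemma adj_dsum S T n : adj S T -> adj (dsum S n) (dsum T n).
Proof.
move=> ST; elim: n => [|n IH] /=; first exact: adj0.
apply: adjD IH _; rewrite -mulrA.
exact: adjM (block_proj n).2 (adjM ST (block_proj n).2).
Qed.

Lemma P_dsum T m n : (m <= n)%N -> P m * dsum T n = dsum T m.
Proof.
have id k l : (k <= l)%N -> P l * dsum T k = dsum T k.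
  elim: k => [|k IH] /= kl; first by rewrite mulr0.
  by rewrite mulrDr IH ?(ltnW kl)// !mulrA P_block_id.
elim: n => [|n IH]; first by rewrite leqn0 => /eqP ->; rewrite mulr0.
rewrite leq_eqVlt => /predU1P[->|]; first exact: id.
by rewrite ltnS => h /=; rewrite mulrDr !mulrA P_block// !mul0r addr0 IH.
Qed.

Lemma dsumB S T n : dsum S n - dsum T n = dsum (S - T) n.
Proof.
elim: n => [|n IH] /=; first by rewrite subrr.
by rewrite opprD addrACA IH (mulrBr (block n)) (mulrBl (block n)).
Qed.

(** Pythagoras on both sides: the new block is orthogonal to the range of [P n], which contains that
    of [dsum T n]. Having [P n x] on the right rather than [x] lets the induction add up. *)
Lemma dsum_hn T n x : hn (dsum T n x) ^+ 2 <= opnorm T ^+ 2 * hn (P n x) ^+ 2.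
Proof.
elim: n => [|n IH].
  have -> : dsum T 0 x = 0 by [].
  by rewrite hn0 expr0n mulr_ge0// sqr_ge0.
rewrite -[dsum T n.+1]/(dsum T n + block n * T * block n).
have orth y z : dot (P n y) (block n z) = 0.
  by rewrite (P_proj n).1.2 -bopM P_block// bop0 dot0r.
have -> : P n.+1 x = P n x + block n x by rewrite bopB addrC subrK.
rewrite bopD (hnD_sqr dot_norm); last first.
  by rewrite -(P_dsum T (leqnn n)) !bopM.
rewrite (hnD_sqr dot_norm (orth x x)) (mulrDr (opnorm T ^+ 2)); apply: lerD => //.
rewrite !bopM -exprMn.
rewrite ler_pXn2r// ?nnegrE ?mulr_ge0 ?hn_ge0 ?opnorm_ge0//.
exact: le_trans (proj_hn dot_norm _ (block_proj n)) (le_op _ _).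
Qed.

Lemma dsum_opnorm T n : opnorm (dsum T n) <= opnorm T.
Proof.
apply: op_le => [|x]; first exact: opnorm_ge0.
rewrite -(@ler_pXn2r _ 2)// ?nnegrE ?mulr_ge0 ?hn_ge0 ?opnorm_ge0//.
rewrite (le_trans (dsum_hn _ _ _))// exprMn ler_wpM2l ?sqr_ge0//.
by rewrite ler_pXn2r// ?nnegrE ?hn_ge0// (proj_hn dot_norm _ (P_proj n).1).
Qed.

Lemma hn_lim_eq x y : (forall e : R, 0 < e -> hn (x - y) <= e) -> x = y.
Proof.
move=> h; apply/eqP; rewrite -subr_eq0; apply/eqP/hn_eq0/eqP.
rewrite eq_le hn_ge0 andbT; apply/ler_addgt0Pr => e /h.
by rewrite add0r.
Qed.

Lemma block_compression : exists D : bop H -> bop H,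
  forall T x (e : R), 0 < e ->
    exists N, forall n, (N <= n)%N -> hn (D T x - dsum T n x) <= e.
Proof.
have /choice[D DP] : forall T, exists D : bop H, forall x,
    (fun n => dsum T n x) @ \oo --> D x.
  move=> T; have /choice[f fP] : forall x, exists y : H,
      (fun n => dsum T n x) @ \oo --> y.
    move=> x; apply: cauchy_hn_cvg => e e0.
    have T1 : 0 < opnorm T + 1 by rewrite ltr_wpDl ?opnorm_ge0.
    have [N NP] := P_lim x (divr_gt0 e0 T1).
    (* The difference of the partial sums is [dsum T m (x - P N x)], which is small uniformly in
       [m]. *)
    exists N => m Nm; rewrite -(dsumP T Nm) bopM -bop_linB.
    rewrite (le_trans (le_op_trans _ (dsum_opnorm T m)))//.
    apply: (@le_trans _ _ (opnorm T * (e / (opnorm T + 1)))).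
      by rewrite ler_wpM2l ?opnorm_ge0// NP.
    by rewrite mulrCA ler_piMr ?(ltW e0)// ler_pdivrMr// mul1r lerDl.
  have [D Df] := bop_pointwise_limit (opnorm_ge0 T) (dsum_opnorm T) fP.
  by exists D => x; rewrite Df.
by exists D => T x e e0; exact: (cvg_hnP _ _).1 (DP T x) _ e0.
Qed.

Variable D : bop H -> bop H.
Hypothesis DP : forall T x (e : R), 0 < e ->
  exists N, forall n, (N <= n)%N -> hn (D T x - dsum T n x) <= e.

Lemma D_P T m : D T * P m = dsum T m.
Proof.
apply: bop_ext => x; apply: hn_lim_eq => e e0.
have [N NP] := DP T (P m x) e0.
have := NP (maxn N m) (leq_maxl _ _).
by rewrite -[dsum T _ (P m x)]bopM dsumP// leq_maxr.
Qed.

Lemma P_D T m : P m * D T = dsum T m.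
Proof.
apply: bop_ext => x; apply: hn_lim_eq => e e0; have [N NP] := DP T x e0.
rewrite -(P_dsum T (leq_maxr N m)) !bopM -bop_linB.
exact: le_trans (proj_hn dot_norm _ (P_proj m).1) (NP _ (leq_maxl _ _)).
Qed.

Lemma D_comm T m : D T * P m = P m * D T. Proof. by rewrite D_P P_D. Qed.

(** [D] is known only through pointwise limits, so contractivity is stated for differences and
    inherited from [dsumB] and [dsum_opnorm]. *)
Lemma D_dist S T : opnorm (D S - D T) <= opnorm (S - T).
Proof.
apply: op_le => [|x]; first exact: opnorm_ge0.
apply/ler_addgt0Pr => e e0; have e20 : 0 < e / 2 by rewrite divr_gt0.
have [N NP] := DP S x e20; have [M MP] := DP T x e20.
have := NP (maxn N M) (leq_maxl _ _); have := MP (maxn N M) (leq_maxr _ _).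
set n := maxn N M => h1 h2.
have h3 := le_op_trans x (dsum_opnorm (S - T) n).
rewrite -dsumB bopB in h3.
have h4 := hn_trans (dsum S n x) (D S x) (D T x).
have h5 := hn_trans (dsum T n x) (dsum S n x) (D T x).
rewrite [hn (dsum T n x - _)]hnC in h5; rewrite bopB; lra.
Qed.

Lemma adj_D S T : adj S T -> adj (D S) (D T).
Proof.
move=> ST; apply: (adj_limit dot_norm) => x y e e0.
have [N NP] := DP S x e0; have [M MP] := DP T y e0.
exists (dsum S (maxn N M)), (dsum T (maxn N M)); split.
- exact: adj_dsum.
- exact: NP (leq_maxl _ _).
- exact: MP (leq_maxr _ _).
Qed.

(** Put [u n = T * P (n + m) - dsum T (n + m)]. With [k = n + m] and [E] the block [k], its
    increment is the commutator of [T] and [E] times [E], of norm at most [2 * e / 2 ^+ k].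
    Summation doubles the constant, and [u] converges strongly to [T - D T]. *)
Lemma D_close T (e : R) m :
  (forall n, (m <= n)%N -> opnorm (T * P n - P n * T) <= e / 2 ^+ n) ->
  opnorm (T - D T - (T * P m - dsum T m)) <= 4 * e / 2 ^+ m.
Proof.
move=> h; pose u n : bop H := T * P (n + m)%N - dsum T (n + m).
have ustep n : opnorm (u n.+1 - u n) <= 2 * e / 2 ^+ m / 2 ^+ n.
  set k := (n + m)%N; have mk : (m <= k)%N by rewrite leq_addl.
  have -> : u n.+1 - u n = (T * block k - block k * T) * block k.
    rewrite (mulrBl (block k)) -(mulrA T) (block_proj k).1 /u addSn -/k.
    have -> : dsum T k.+1 = dsum T k + block k * T * block k by [].
    by rewrite subrACA -mulrBr -/(block k) [dsum T k + _ - _]addrC addKr.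
  rewrite (le_trans (mul_proj_opnorm dot_norm _ (block_proj k)))//.
  have -> : T * block k - block k * T =
      (T * P k.+1 - P k.+1 * T) - (T * P k - P k * T).
    by rewrite mulrBr mulrBl subrACA.
  rewrite (le_trans (opnormB _ _))//.
  have h1 := h _ (leq_trans mk (leqnSn k)); have h2 := h _ mk.
  have e0 : 0 <= e / 2 ^+ k := le_trans (opnorm_ge0 _) h2.
  have -> : 2 * e / 2 ^+ m / 2 ^+ n = 2 * (e / 2 ^+ k).
    by rewrite /k exprD invfM; ring.
  have e1 : e / 2 ^+ k.+1 = (e / 2 ^+ k) / 2 by rewrite exprSr invfM; ring.
  by rewrite e1 in h1; lra.
have tail n : opnorm (u n - u 0%N) <= 4 * e / 2 ^+ m.
  have := @geometric_tail R (bop H) _ u ustep 0%N n isT.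
  by rewrite expr0 divr1 !mulrA -natrM; exact.
have e0 : 0 <= 4 * e / 2 ^+ m := le_trans (opnorm_ge0 _) (tail 0%N).
apply: op_le => // x; apply/ler_addgt0Pr => r r0.
pose C := opnorm T + 1.
have C0 : 0 < C by rewrite ltr_wpDl ?opnorm_ge0.
have r1 : 0 < r / (2 * C) by rewrite divr_gt0 ?mulr_gt0.
have [N NP] := P_lim x r1; have [M MP] := DP T x (divr_gt0 r0 (ltr0n R 2)).
set n := maxn N M; have Nn : (N <= n + m)%N.
  by rewrite (leq_trans (leq_maxl N M)) ?leq_addr.
have Mn : (M <= n + m)%N by rewrite (leq_trans (leq_maxr N M)) ?leq_addr.
have h1 := NP _ Nn; have h2 := MP _ Mn.
have h3 := le_op_trans x (tail n).
have h4 : hn (T (x - P (n + m)%N x)) <= r / 2.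
  rewrite (le_trans (le_op _ _))//.
  apply: (@le_trans _ _ (C * (r / (2 * C)))).
    by rewrite ler_pM ?opnorm_ge0 ?hn_ge0// /C lerDl.
  by rewrite le_eqVlt; apply/orP; left; apply/eqP; field; rewrite gt_eqF.
have -> : (T - D T - (T * P m - dsum T m)) x =
    (T (x - P (n + m)%N x) - (D T x - dsum T (n + m) x)) + (u n - u 0%N) x.
  rewrite /u add0n !bopB !bopM bop_linB.
  by rewrite [in RHS]subrACA addrA subrK.
have h5 := hnD (T (x - P (n + m)%N x) - (D T x - dsum T (n + m) x)) ((u n - u 0%N) x).
have h6 := hnB (T (x - P (n + m)%N x)) (D T x - dsum T (n + m) x).
by lra.
Qed.

Lemma D_close0 T (e : R) :
  (forall n, opnorm (T * P n - P n * T) <= e / 2 ^+ n) ->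
  opnorm (T - D T) <= 4 * e.
Proof.
move=> h; have := @D_close T e 0%N (fun n _ => h n).
by rewrite P0 mulr0 subr0 subr0 expr0 divr1.
Qed.

(** By [D_P], the operator subtracted in [D_close] is [(T - D T) * P m], which has finite rank; let
    [m] grow. *)
Lemma D_negligible T (e : R) m0 :
  (forall n, (m0 <= n)%N -> opnorm (T * P n - P n * T) <= e / 2 ^+ n) ->
  negligible (T - D T).
Proof.
move=> h r r0; have [n nP] := geometric_lt (4 * e) r0.
have e0 : 0 <= 4 * e.
  have := le_trans (opnorm_ge0 _) (h _ (leqnn m0)).
  by rewrite pmulr_lge0 ?invr_gt0 ?exprn_gt0//; lra.
pose m := maxn m0 n.
exists (T * P m - dsum T m); split.
  rewrite -D_P -mulrBl; apply: finite_rankMl; exact: (P_proj m).2.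
rewrite (le_trans (@D_close T e m _))//.
  by move=> k mk; apply: h; rewrite (leq_trans (leq_maxl _ _) mk).
rewrite (le_trans _ (ltW nP))// ler_wpM2l// lef_pV2 ?posrE ?exprn_gt0//.
by rewrite ler_weXn2l ?ler1n// leq_maxr.
Qed.

(** Commutator decay is available only along a dense sequence of [A]; contractivity of [D] extends
    the conclusion to all of [A]. *)
Lemma D_negligible_closed T :
  (forall e : R, 0 < e -> exists2 S, negligible (S - D S) & opnorm (T - S) <= e) ->
  negligible (T - D T).
Proof.
move=> h; apply: (@negligible_le _ _ _ 3) => // e e0.
have [S hS TS] := h _ e0.
have -> : T - D T = (T - S) + (S - D S) + (D S - D T).
  by rewrite !addrA !subrK.
have -> : 3 * e = e + e + e by ring.
apply: (essD dot_norm); first apply: (essD dot_norm).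
- exact: ess_opnorm.
- exact: hS.
- apply: (ess_opnorm dot_norm); rewrite opnormB_sym.
  exact: le_trans (D_dist _ _) TS.
Qed.

End BlockDiagonal.

(** * Countable dense families *)

Section Separability.
Variables (R : realType) (V : normedModType R[i]).
Implicit Types (x y : V) (A B : set V).

Lemma separable_enum A x0 : A x0 -> separable_set A ->
  exists f : nat -> V, (forall n, A (f n)) /\
    forall x, A x -> forall e : R, 0 < e -> exists n, hn (x - f n) <= e.
Proof.
move=> Ax0 [D [cD DA AD]].
have [y0 Dy0 _] := (closure_hnP _ _).1 (AD _ Ax0) _ ltr01.
have : D !=set0 by exists y0.
move/pfcard_geP : cD => [->|[f]]; first by move=> /set0P; rewrite eqxx.
move=> _; exists f; split=> [n|x /AD/closure_hnP Dx e /Dx[y Dy xy]].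
  by apply: DA; exact: funS.
have [n _ nP] := @surj _ _ _ _ f _ Dy.
by exists n; rewrite nP.
Qed.

(** The family may lie outside [B]. For each index and each tolerance [1 / 2 ^+ n], choose an
    element of [B] that close to [c i] if there is one, and [x0] otherwise; the chosen elements are
    countable and dense. *)
Lemma separable_family B (I : countType) (c : I -> V) x0 : B x0 ->
  (forall x, B x -> forall e : R, 0 < e -> exists i, hn (x - c i) <= e) ->
  separable_set B.
Proof.
move=> Bx0 h; have /choice[b bP] : forall p : I * nat, exists y, B y /\
    forall x, B x -> hn (x - c p.1) <= 1 / 2 ^+ p.2 -> hn (y - c p.1) <= 1 / 2 ^+ p.2.
  move=> [i n] /=.
  have [[y [By yP]]|nP] := pselect (exists y, B y /\ hn (y - c i) <= 1 / 2 ^+ n).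
    by exists y.
  by exists x0; split=> // x Bx xc; case: nP; exists x.
exists (range b); split.
- exact: (card_le_trans (card_image_le _ _) (countableP _)).
- by move=> _ [p _ <-]; have [] := bP p.
- move=> x Bx; apply/closure_hnP => e e0; have [n nP] := geometric_lt 2 e0.
  have [|i iP] := h x Bx (1 / 2 ^+ n); first by rewrite divr_gt0 ?exprn_gt0.
  exists (b (i, n)); first by exists (i, n).
  have [_ /(_ x Bx iP) /= bi] := bP (i, n).
  rewrite (le_trans (hn_trans (c i) _ _))// (le_trans _ (ltW nP))//.
  have -> : 2 / 2 ^+ n = 1 / 2 ^+ n + 1 / 2 ^+ n :> R by ring.
  by rewrite lerD// hnC.
Qed.

End Separability.

(** * The block diagonal algebra attached to the projections *)

Section BlockDiagonalAlgebra.
Variables (R : realType) (H : completeNormedModType R[i]).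
Variable dot : {dot H for @Num.conj R[i]}.
Hypothesis dot_norm : forall x : H, `|x| ^+ 2 = dot x x.
Implicit Types (x y z : H) (Q S T X Y : bop H).
Notation adj := (adjoint dot).
Notation rank1 := (rank1 dot_norm).

Variable xi : nat -> H.
Hypothesis xi_dense : forall x (e : R), 0 < e -> exists n, hn (x - xi n) <= e.

Lemma rank1_approx v w (e : R) : 0 < e ->
  exists p : nat * nat, opnorm (rank1 v w - rank1 (xi p.1) (xi p.2)) <= e.
Proof.
move=> e0; have ek a : 0 <= a -> 0 < e / (2 * (a + 1)).
  by move=> a0; rewrite divr_gt0// mulr_gt0// ltr_wpDl.
have ea a : 0 <= a -> e / (2 * (a + 1)) * a <= e / 2.
  move=> a0; have a1 : 0 < a + 1 by rewrite ltr_wpDl.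
  rewrite mulrAC ler_pdivrMr ?mulr_gt0// -mulrA ler_wpM2l ?(ltW e0)//.
  by rewrite mulrA mulVf// mul1r lerDl.
have [m mP] := xi_dense v (ek _ (hn_ge0 w)).
(* The second tolerance depends on the vector [xi m] already chosen, since the error [w - xi n] gets
   multiplied by its norm. *)
have [n nP] := xi_dense w (ek _ (hn_ge0 (xi m))).
exists (m, n) => /=.
have -> : rank1 v w - rank1 (xi m) (xi n) =
    rank1 (v - xi m) w + rank1 (xi m) (w - xi n).
  apply: bop_ext => x; rewrite bopB bopD !rank1E dotBr scalerBl scalerBr.
  by rewrite addrA subrK.
rewrite (le_trans (opnorm_triangle _ _))// [leRHS](splitr e) lerD//.
  rewrite (le_trans (opnorm_rank1 _ _ _))// (le_trans _ (ea _ (hn_ge0 w)))//.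
  by rewrite ler_wpM2r ?hn_ge0.
rewrite (le_trans (opnorm_rank1 _ _ _))// (le_trans _ (ea _ (hn_ge0 (xi m))))//.
by rewrite mulrC ler_wpM2r ?hn_ge0.
Qed.

Lemma sum_rank1_approx (t : seq H) (g : H -> H) (e : R) : 0 < e ->
  exists s : seq (nat * nat),
    opnorm (\sum_(v <- t) rank1 v (g v) -
            \sum_(p <- s) rank1 (xi p.1) (xi p.2)) <= e.
Proof.
elim: t e => [|v t IH] e e0.
  by exists [::]; rewrite !big_nil subrr opnorm0 ltW.
have e20 : 0 < e / 2 by rewrite divr_gt0.
have [s sP] := IH _ e20; have [p pP] := rank1_approx v (g v) e20.
exists (p :: s); rewrite !big_cons opprD addrACA.
by rewrite (le_trans (opnorm_triangle _ _))// [leRHS](splitr e) lerD.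
Qed.

(** The approximant [diag_sum t * X] is the sum of the [rank1 v (Y v)], whose two vectors can each
    be replaced by entries of [xi]. *)
Lemma negligible_approx X Y (e : R) : 0 < e -> adj X Y -> negligible X ->
  exists s : seq (nat * nat),
    opnorm (X - \sum_(p <- s) rank1 (xi p.1) (xi p.2)) <= e.
Proof.
move=> e0 XY hX; have e20 : 0 < e / 2 by rewrite divr_gt0.
have [t [_ tX]] := essP dot_norm (hX _ e20).
have [s sP] := sum_rank1_approx t Y e20; exists s.
have tE : diag_sum dot_norm t * X = \sum_(v <- t) rank1 v (Y v).
  rewrite /diag_sum mulr_suml; apply: eq_bigr => v _.
  exact: rank1_mul XY.
rewrite tE in tX; rewrite [leRHS](splitr e).
exact (le_trans (opnorm_dist_triangle _ _ _) (lerD tX sP)).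
Qed.

Variables (P : nat -> bop H) (A : set (bop H)) (T_ : nat -> bop H).
Hypothesis P_proj : forall n, fin_proj dot (P n).
Hypothesis P_mono : forall n, P n.+1 * P n = P n.
Hypothesis P_lim : forall x (e : R), 0 < e ->
  exists N, forall n, (N <= n)%N -> hn (x - P n x) <= e.
Hypothesis A_cstar : cstar_algebra dot A.
Hypothesis T_dense : forall T, A T -> forall e : R, 0 < e ->
  exists n, opnorm (T - T_ n) <= e.

(** Having an adjoint is a membership condition here: it makes stability under adjoints direct and
    survives norm limits by [adjointable_closed]. *)
Definition block_part : set (bop H) := [set S |
  [/\ forall n, S * P n = P n * S, exists S', adj S S' &
      exists2 T, A T & negligible (S - T)]].

Lemma block_part0 : block_part 0.
Proof.
have [[A0 _ _] _ _ _] := A_cstar; split=> [n||].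
- by rewrite mul0r mulr0.
- by exists 0; exact: adj0.
- by exists 0 => //; rewrite subrr; exact (negligible0 dot_norm).
Qed.

Lemma block_part_cstar : cstar_algebra dot block_part.
Proof.
have [[A0 AD AZ] AM Aadj _] := A_cstar.
split; first split.
- exact: block_part0.
- move=> S T [SP [S' SS'] [S1 AS1 hS]] [TP [T' TT'] [T1 AT1 hT]]; split=> [n||].
  + by rewrite mulrDl mulrDr SP TP.
  + by exists (S' + T'); exact: adjD.
  + exists (S1 + T1); first exact: AD.
    by rewrite opprD addrACA; exact (negligibleD dot_norm hS hT).
- move=> a S [SP [S' SS'] [S1 AS1 hS]]; split=> [n||].
  + apply: bop_ext => x; have := congr1 (fun U : bop H => a *: U x) (SP n).
    by rewrite !bopM !bopZ bop_linZ.
  + by exists (a^*%R *: S'); exact: adjZ.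
  + by exists (a *: S1); [exact: AZ|rewrite -scalerBr; exact (negligibleZ a hS)].
- move=> S T [SP [S' SS'] [S1 AS1 hS]] [TP [T' TT'] [T1 AT1 hT]]; split=> [n||].
  + by rewrite -mulrA TP mulrA SP mulrA.
  + by exists (T' * S'); exact: adjM.
  + exists (S1 * T1); first exact: AM.
    have -> : S * T - S1 * T1 = (S - S1) * T + S1 * (T - T1).
      by rewrite mulrBl mulrBr addrA subrK.
    exact (negligibleD dot_norm (negligibleMr dot_norm T hS) (negligibleMl S1 hT)).
- move=> S [SP [S' SS'] [S1 AS1 hS]]; exists S' => //; split=> [n||].
  + have := adjM SS' (P_proj n).1.2; rewrite SP => h.
    by rewrite (adj_inj dot_norm h (adjM (P_proj n).1.2 SS')).
  + by exists S; exact: adj_sym.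
  + have [S1' AS1' S1S1'] := Aadj _ AS1.
    by exists S1'; [exact: AS1'|exact (negligible_adj dot_norm (adjB SS' S1S1') hS)].
(* Closedness, condition by condition: commutation is norm continuous, adjoints pass to limits, and
   A + K(H) is closed. *)
- move=> S /closure_hnP cS; split=> [n||].
  + apply/eqP; rewrite -subr_eq0; apply/eqP/opnorm_eq0.
    suff -> : opnorm (S * P n - P n * S) = 0 by [].
    apply/eqP; rewrite eq_le opnorm_ge0 andbT; apply/ler_addgt0Pr => e e0.
    have [T [TP _ _] ST] := cS _ (divr_gt0 e0 (ltr0n R 2)).
    have -> : S * P n - P n * S = (S - T) * P n - P n * (S - T).
      by rewrite mulrBl mulrBr TP subrACA subrr subr0.
    rewrite add0r (le_trans (opnormB _ _))// [leRHS](splitr e) lerD//.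
      by rewrite (le_trans (mul_proj_opnorm dot_norm _ (P_proj n).1)).
    by rewrite (le_trans (proj_mul_opnorm dot_norm _ (P_proj n).1)).
  + apply: (adjointable_closed dot_norm) => e /cS[T [_ [T' TT'] _] ST].
    by exists T, T'.
  + apply: (cstar_add_compact_closed dot_norm A_cstar) => e /cS[T [_ _ [T1 AT1 hT]] ST].
    by exists T, T1.
Qed.

Lemma block_part_block_diagonal : block_diagonal_algebra dot block_part.
Proof.
split; first exact: block_part_cstar.
exists P; split=> [//|n x|T n [TP _ _]//|x].
- have pE := block_proj dot_norm P_proj P_mono n.
  rewrite -subr_ge0 -dotBl -bopB (proj_dot dot_norm _ pE).
  by rewrite ler0c sqr_ge0.
- by apply/cvg_hnP => e; exact: P_lim.
Qed.

(** An element is some [T] in [A] plus a negligible operator: approximate [T] by [T_ n] and the rest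
    by rank one sums over [xi]. These sums may leave [block_part], whence [separable_family]. *)
Lemma block_part_separable : separable_set block_part.
Proof.
apply: (@separable_family R (bop H) block_part _
  (fun k : nat * seq (nat * nat) => T_ k.1 + \sum_(p <- k.2) rank1 (xi p.1) (xi p.2))
  0 block_part0).
move=> S [_ [S' SS'] [T AT hST]] e e0; have e20 : 0 < e / 2 by rewrite divr_gt0.
have [_ _ Aadj _] := A_cstar; have [T' _ TT'] := Aadj _ AT.
have [n nP] := T_dense AT e20.
have [s sP] := negligible_approx e20 (adjB SS' TT') hST.
exists (n, s) => /=.
have -> : S - (T_ n + \sum_(p <- s) rank1 (xi p.1) (xi p.2)) =
    (T - T_ n) + (S - T - \sum_(p <- s) rank1 (xi p.1) (xi p.2)).
  rewrite opprD !addrA; congr (_ - _).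
  by rewrite [T - T_ n + S]addrC addrA [RHS]addrAC addrK.
rewrite [leRHS](splitr e).
exact (le_trans (opnorm_triangle _ _) (lerD nP sP)).
Qed.

Lemma block_part_sum (D : bop H -> bop H) :
  (forall T n, D T * P n = P n * D T) ->
  (forall S T, adj S T -> adj (D S) (D T)) ->
  (forall T, A T -> negligible (T - D T)) ->
  (forall T, A T -> block_part (D T)) /\
  setsum A (@compact_operators R H) = setsum block_part (@compact_operators R H).
Proof.
move=> DP Dadj Dneg; have [_ _ Aadj _] := A_cstar.
have DB T : A T -> block_part (D T).
  move=> AT; split=> //; first by have [T' _ /Dadj] := Aadj _ AT; exists (D T').
  by exists T => //; rewrite -opprB; exact: (negligibleN dot_norm (Dneg _ AT)).
split=> //; apply/seteqP; split=> _ [S hS [K /(compactP dot_norm) hK <-]].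
  exists (D S); first exact: DB.
  exists (S - D S + K); last by rewrite addrA [D S + _]addrC subrK.
  exact ((compactP dot_norm _).2 (negligibleD dot_norm (Dneg S hS) hK)).
have [_ _ [T AT hT]] := hS.
exists T => //; exists (S - T + K); last by rewrite addrA [T + _]addrC subrK.
exact ((compactP dot_norm _).2 (negligibleD dot_norm hT hK)).
Qed.

End BlockDiagonalAlgebra.

(** * Assembly of the two implications *)

Theorem theorem5p2 (R : realType) (H : completeNormedModType R[i])
    (dot : {dot H for @Num.conj R[i]})
    (dot_norm : forall x : H, `|x| ^+ 2 = dot x x)
    (H_separable : separable_set [set: H])
    (A : set (bop H))
    (A_cstar : cstar_algebra dot A) (A_separable : separable_set A) :
  quasidiagonal_set dot A <->
  (forall (F : set (bop H)) (eps : R),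
     finite_set F -> F `<=` A -> 0 < eps ->
     exists B : set (bop H),
       [/\ block_diagonal_algebra dot B, separable_set B,
           approx_contained F eps B &
           setsum A (@compact_operators R H) =
           setsum B (@compact_operators R H)]).
Proof.
split=> [A_qd F eps /finite_seqP[s ->] sA eps0|h omega chi eps fo oA fc eps0].
  have [[A0 _ _] _ _ _] := A_cstar.
  have [T_ [AT_ T_dense]] := @separable_enum R (bop H) _ _ A0 A_separable.
  have [xi [_ xi_dense]] := separable_enum (x0 := 0 : H) I H_separable.
  (* [D_close0] multiplies this by 4, so [D S] is within [eps / 2] of [S], which is strictly below
     [eps]. *)
  have e0 : 0 < eps / 8 by rewrite divr_gt0.
  have [P [P0 P_proj P_mono [sP TP xiP]]] :=
    quasidiagonal_sequence dot_norm A_qd (T_ := T_) xi AT_ sA e0.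
  have P_lim x (e : R) : 0 < e ->
      exists N, forall n, (N <= n)%N -> hn (x - P n x) <= e.
    move=> e_gt0; have e30 : 0 < e / 3 by rewrite divr_gt0.
    have [k kP] := xi_dense x I _ e30.
    have [N NP] := geometric_lt (eps / 8) e30.
    (* [P n] nearly fixes [xi k] only for [k < n]. The three errors of size [e / 3] come from
       replacing [x] by [xi k], applying [P n], and returning to [x]. *)
    exists (maxn N k.+1) => n; rewrite geq_max => /andP[Nn kn].
    have h1 := xiP k n kn.
    have h2 : eps / 8 / 2 ^+ n <= eps / 8 / 2 ^+ N.
      rewrite ler_wpM2l ?(ltW e0)// lef_pV2 ?posrE ?exprn_gt0//.
      by rewrite ler_weXn2l ?ler1n.
    have h3 := hn_trans (xi k) x (P n x).
    have h4 := hn_trans (P n (xi k)) (xi k) (P n x).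
    have h5 : hn (P n (xi k) - P n x) <= hn (x - xi k).
      by rewrite -bop_linB hnC (proj_hn dot_norm _ (P_proj n).1).
    rewrite [hn (xi k - P n (xi k))]hnC in h4; lra.
  have [D DP] := block_compression dot_norm P_proj P_mono P_lim.
  have D_neg T : A T -> negligible (T - D T).
    move=> AT; apply: (D_negligible_closed dot_norm P_proj P_mono DP) => e e_gt0.
    have [k kP] := T_dense _ AT _ e_gt0; exists (T_ k) => //.
    apply: (D_negligible dot_norm P_proj P_mono P_lim DP (e := eps / 8) (m0 := k.+1)).
    by move=> n kn; exact: TP.
  have [DB sumE] := block_part_sum dot_norm A_cstar
    (D_comm dot_norm P_proj P_mono DP) (adj_D dot_norm P_proj P_mono DP) D_neg.
  exists (block_part dot P A); split.
  - exact (block_part_block_diagonal dot_norm P_proj P_mono P_lim A_cstar).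
  - exact (block_part_separable dot_norm (fun x => xi_dense x I) P A_cstar T_dense).
  - move=> S Ss; exists (D S); first by apply: DB; exact: sA.
    rewrite bop_normE ltcR.
    apply: le_lt_trans (D_close0 dot_norm P0 P_proj P_mono P_lim DP _) _.
      by move=> n; exact: sP.
    lra.
  - exact sumE.
have e40 : 0 < eps / 2 by rewrite divr_gt0.
have [B [[_ [P [P_proj _ BP P_cvg]]] _ oB _]] := h omega (eps / 2) fo oA e40.
have /finite_seqP[t tE] := fc.
have [N NP] : exists N, forall x, x \in t -> hn (P N x - x) <= eps.
  (* Asking for all later indices lets the induction over the list merge two thresholds by their
     maximum. *)
  suff [N NP] : exists N, forall n, (N <= n)%N ->
      forall x, x \in t -> hn (P n x - x) <= eps.
    by exists N; exact: NP.
  elim: {tE} t => [|v t [N NP]]; first by exists 0%N.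
  have [M MP] := (cvg_hnP _ _).1 (P_cvg v) _ eps0.
  exists (maxn N M) => n; rewrite geq_max => /andP[Nn Mn] x.
  by rewrite inE => /predU1P[->|xt]; [rewrite hnC MP|exact: NP].
exists (P N); split; [exact: (P_proj N).1|exact: (P_proj N).2| |].
  move=> T oT; have [S BS TS] := oB _ oT.
  rewrite bop_normE ltcR in TS; rewrite bop_normE lecR.
  have -> : T * P N - P N * T = (T - S) * P N - P N * (T - S).
    by rewrite mulrBl mulrBr (BP _ N BS) subrACA subrr subr0.
  rewrite (le_trans (opnormB _ _))// [leRHS](splitr eps) lerD//.
    by rewrite (le_trans (mul_proj_opnorm dot_norm _ (P_proj N).1))// ltW.
  by rewrite (le_trans (proj_mul_opnorm dot_norm _ (P_proj N).1))// ltW.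
by move=> x; rewrite tE => /NP; rewrite hnE lecR.
Qed.
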